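(* Let $\overline{r}=0.466\dots$ denote the unique $r\in(0,1)$ satisfying $\tfrac32 r\log r-r+1=0$, and let $\underline{r}=0.209\dots$ denote the maximum value of $r<1$ such that the function $f_r$ (defined in the context) has a zero in the open interval $(0,r)$. There exist functions $\underline{q},\overline{q}\colon(0,1)\to(0,1)$ satisfying $0<\underline{q}(p)\le\overline{q}(p)\le p$ for all $0<p<1$ with the following properties. Whenever $\overline{q}(p)<q<p$, the constant graphon $W\equiv q$ is the unique minimizer for $\mathsf{LT}_p(K_3,q)$. Whenever $0<q<\underline{q}(p)$, the constant graphon $W\equiv q$ does not minimize $\mathsf{LT}_p(K_3,q)$. Furthermore, $\lim_{p\to0}\underline{q}(p)/p=\underline{r}=0.209\dots$ and $\lim_{p\to0}\overline{q}(p)/p=\overline{r}=0.466\dots$.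
   Context: A graphon is a symmetric measurable function $W\colon[0,1]^2\to[0,1]$. $K_3$ is the triangle, and $t(K_3,W):=\int_{[0,1]^3}W(x,y)W(x,z)W(y,z)\,dx\,dy\,dz$. For a function $f$, write $\mathbb{E}[f(W)]:=\int_{[0,1]^2}f(W(x,y))\,dx\,dy$. For $0<p<1$ and $x\in[0,1]$, $I_p(x):=x\log\frac{x}{p}+(1-x)\log\frac{1-x}{1-p}$ (with $0\log 0=0$). For $0\le q\le p$, $\mathsf{LT}_p(K_3,q)$ denotes the variational problem (and also its value): minimize $\mathbb{E}[I_p(W)]$ over all graphons $W$ subject to $t(K_3,W)\le q^3$. Graphons are identified if they differ on a set of measure zero or by a measure-preserving transformation of $[0,1]$ (i.e. $W$ is identified with $W^\sigma(x,y)=W(\sigma(x),\sigma(y))$ for $\sigma\colon[0,1]\to[0,1]$ measure-preserving); uniqueness of minimizers is understood up to this identification. Let $h(x):=x\log x-x+1$ (with $h(0)=1$). For $0<r<1$, define $f_r(x):=\tfrac12h(x)+\tfrac12h\Big(\sqrt{\tfrac{4r^3-x^3}{3x}}\Big)-h(r)$ for those $x\in(0,r]$ with $\sqrt{(4r^3-x^3)/(3x)}\le1$. *)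

(* Defs.v *)
From HB Require Import structures.
From mathcomp Require Import all_boot all_order all_algebra.
From mathcomp Require Import all_classical all_reals all_analysis.
From Stdlib Require Import Relation_Operators.
Import Order.TTheory GRing.Theory Num.Theory.
Import numFieldNormedType.Exports.

Set Implicit Arguments.
Unset Strict Implicit.
Unset Printing Implicit Defensive.

Local Open Scope classical_set_scope.
Local Open Scope ring_scope.

Definition unitI (R : realType) : set R := `[0, 1]%classic.
Arguments unitI {R}.

(* Only the restriction of W to [0,1]^2 is relevant: no definition below looks
   at the values of W elsewhere. *)
Definition graphon (R : realType) (W : R -> R -> R) : Prop :=
  [/\ measurable_fun (unitI `*` unitI) (fun z : R * R => W z.1 z.2),
      (forall x y, unitI x -> unitI y -> 0 <= W x y <= 1) &
      (forall x y, unitI x -> unitI y -> W x y = W y x)].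

(* t(K_3, W); z.1.1, z.1.2 and z.2 are the three vertices. *)
Definition triangle_density (R : realType) (W : R -> R -> R) : \bar R :=
  (\int[(@lebesgue_measure R \x @lebesgue_measure R) \x @lebesgue_measure R]_(
      z in (unitI `*` unitI) `*` unitI)
     (W z.1.1 z.1.2 * W z.1.1 z.2 * W z.1.2 z.2)%R%:E)%E.

(* E[f(W)] *)
Definition graphon_expect (R : realType) (f : R -> R) (W : R -> R -> R)
    : \bar R :=
  (\int[@lebesgue_measure R \x @lebesgue_measure R]_(z in unitI `*` unitI)
     (f (W z.1 z.2))%:E)%E.

(* The convention 0 log 0 = 0 holds because the factor in front of ln is 0. *)
Definition rel_entropy (R : realType) (p x : R) : R :=
  x * ln (x / p) + (1 - x) * ln ((1 - x) / (1 - p)).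

Definition LT_feasible (R : realType) (q : R) (W : R -> R -> R) : Prop :=
  graphon W /\ (triangle_density W <= (q ^+ 3)%:E)%E.

Definition LT_minimizer (R : realType) (p q : R) (W : R -> R -> R) : Prop :=
  LT_feasible q W /\
  forall W' : R -> R -> R, LT_feasible q W' ->
    (graphon_expect (rel_entropy p) W <= graphon_expect (rel_entropy p) W')%E.

(* Measure-preserving maps of [0,1], not necessarily bijective. *)
Definition measure_preserving (R : realType) (s : R -> R) : Prop :=
  [/\ measurable_fun unitI s,
      (forall x, unitI x -> unitI (s x)) &
      (forall A : set R, measurable A -> A `<=` unitI ->
         @lebesgue_measure R (unitI `&` s @^-1` A) = @lebesgue_measure R A)].

Definition graphon_ae_eq (R : realType) (W W' : R -> R -> R) : Prop :=
  {ae (@lebesgue_measure R \x @lebesgue_measure R)%E, forall z : R * R,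
     (unitI `*` unitI) z -> W z.1 z.2 = W' z.1 z.2}.

Definition graphon_pullback (R : realType) (W W' : R -> R -> R) : Prop :=
  exists s : R -> R, measure_preserving s /\
    forall x y, unitI x -> unitI y -> W' x y = W (s x) (s y).

(* Identification of graphons: the equivalence relation generated by equality
   almost everywhere and by W ~ W^s, all intermediate functions being
   graphons. *)
Definition graphon_equiv (R : realType) : (R -> R -> R) -> (R -> R -> R) -> Prop :=
  @clos_refl_sym_trans (R -> R -> R) (fun W W' =>
    [/\ graphon W, graphon W' & graphon_ae_eq W W' \/ graphon_pullback W W']).

Definition LT_unique_minimizer (R : realType) (p q : R) (W : R -> R -> R)
    : Prop :=
  LT_minimizer p q W /\
  forall W' : R -> R -> R, LT_minimizer p q W' -> graphon_equiv W W'.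

Definition const_graphon (R : realType) (q : R) : R -> R -> R := fun _ _ => q.

(* h(0) = 1 since 0 * ln 0 = 0. *)
Definition h (R : realType) (x : R) : R := x * ln x - x + 1.

Definition f_other (R : realType) (r x : R) : R :=
  Num.sqrt ((4 * r ^+ 3 - x ^+ 3) / (3 * x)).

Definition f_dom (R : realType) (r : R) : set R :=
  [set x | 0 < x <= r /\ f_other r x <= 1].

Definition f (R : realType) (r x : R) : R :=
  h x / 2 + h (f_other r x) / 2 - h r.

Definition f_has_zero (R : realType) : set R :=
  [set r | 0 < r < 1 /\ exists x : R, [/\ f_dom r x, 0 < x < r & f r x = 0]].
Arguments f_has_zero {R}.

(* Main.v *)
Require Import Defs.
From HB Require Import structures.
From mathcomp Require Import all_boot all_order all_algebra.
From mathcomp Require Import all_classical all_reals all_analysis.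
From mathcomp Require Import measurable_realfun.
From mathcomp Require Import ring lra.
Import Order.TTheory GRing.Theory Num.Theory.
Import numFieldNormedType.Exports.

Set Implicit Arguments.
Unset Strict Implicit.
Unset Printing Implicit Defensive.

Local Open Scope classical_set_scope.
Local Open Scope ring_scope.

(** Both halves of the theorem reduce to inequalities for [h], the limit of
    [x |-> rel_entropy p (p x) / p] as [p] tends to [0].

    _Large [q]._  Let [I] be the relative entropy with respect to [p].  If some
    [C >= 0] satisfies [I a + I b + I c + C a b c >= 3 I q + C q^3] for all edge
    weights [a, b, c] of a triangle, then integrating over the cube gives
    [3 E(I(W)) + C t(W) >= 3 I q + C q^3] for each graphon [W], so the constant
    [q] is a minimizer.  The tangent line of [I] at [q] dictates [C], and after
    scaling by [q] the pointwise inequality follows from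
    [h u + h v + h w + theta (u v w - u - v - w + 2) >= 0], where [theta] is
    minus the derivative of [I] at [q].  By [h_triangle_ge0] this holds on
    [0, 215/100]^3 for [theta = 77/100], hence for every smaller [theta] with a
    margin proportional to [h u + h v + h w]; the range covers every
    [q > 466/1000 p] when [p <= 1/250].  As [h] vanishes only at [1], the margin
    also gives uniqueness.  The resulting threshold is at most [rbar p], so
    [qbar p] may be [rbar p] for small [p] and [p] otherwise.

    _Small [q]._  A zero of [f r] is a two-block graphon, with value [x] on two
    diagonal blocks and [y] elsewhere, that has the triangle density and the
    [h]-entropy of the constant [r]; its mean exceeds [r].  Multiplying both
    graphons by [s < 1] creates a difference of [h]-entropies equal to [s ln s]
    times the excess [e] of the mean, in favour of the two blocks.  Passing from
    [h] to the true entropy divided by [p] costs at most [p s^2], so the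
    two-block graphon wins whenever [ln s < - p / e] ([two_block_gain]).  Thus
    [qlow p = rlow p exp (- p / e)] works for every [p].

    _The constant [rlow]._  The same scaling makes [f r (r u) / r] affine in
    [ln r], so the zeros of [f r], for all [r] together, form the graph of an
    explicit function [rho] of [u = x / r], and [rlow] is the maximum of [rho]
    under the constraint [f_other r x <= 1].  It is located by bounding
    [x ln x] below by a few tangent lines and by evaluating [rho] at [2/25]. *)

(** * Bounds on the exponential and the logarithm *)

(** By the mean value theorem on either side of [a], the point away from which
    [F] increases; [min] and [max] cover both positions of [b]. *)
Lemma le_at_basin (R : realType) (F dF : R -> R) (a b : R) :
  (forall x, Num.min a b <= x <= Num.max a b -> is_derive x 1 F (dF x)) ->
  (forall x, Num.min a b < x < Num.max a b -> 0 <= dF x * (x - a)) ->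
  F a <= F b.
Proof.
move=> FdF sgn.
have wcont : {within `[Num.min a b, Num.max a b], continuous F}.
  apply: derivable_within_continuous => x; rewrite in_itv /= => xab.
  by have [] := FdF _ xab.
have oder x : x \in `]Num.min a b, Num.max a b[ -> is_derive x 1 F (dF x).
  by rewrite in_itv /= => /andP[x1 x2]; apply: FdF; rewrite !ltW.
case: (ltgtP a b) wcont oder sgn => [ab|ba|->//] wcont oder sgn.
- have [c] := MVT ab oder wcont.
  rewrite in_itv /= => /[dup] cab /andP[ac cb] E.
  have := sgn _ cab; nra.
- have [c] := MVT ba oder wcont.
  rewrite in_itv /= => /[dup] cab /andP[ac cb] E.
  have := sgn _ cab; nra.
Qed.

Definition exp_taylor (R : realType) n (x : R) : R :=
  \sum_(i < n) x ^+ i / i`!%:R.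

Lemma exp_taylorS (R : realType) n (x : R) :
  exp_taylor n.+1 x = exp_taylor n x + x ^+ n / n`!%:R.
Proof. by rewrite /exp_taylor big_ord_recr. Qed.

Lemma exp_taylor0 (R : realType) n : exp_taylor n.+1 (0 : R) = 1.
Proof.
rewrite /exp_taylor big_ord_recl big1 ?addr0 ?expr0 ?fact0 ?divr1 // => i _.
by rewrite lift0 expr0n mul0r.
Qed.

Lemma is_derive_exp_taylor (R : realType) n (x : R) :
  is_derive x 1 (exp_taylor n.+1) (exp_taylor n x).
Proof.
elim: n => [|n IH].
  rewrite /exp_taylor big_ord0.
  have -> : (fun x : R => \sum_(i < 1) x ^+ i / i`!%:R) = cst 1.
    by apply/funext => y; rewrite big_ord_recl big_ord0 addr0 expr0 divr1.
  exact: is_derive_cst.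
have -> : exp_taylor n.+2 =
    exp_taylor n.+1 + ((n.+1)`!%:R^-1 : R) *: (fun y : R => y ^+ n.+1).
  apply/funext => y; rewrite exp_taylorS mulrC.
  by rewrite /= /GRing.add /= /GRing.scale.
have dX : is_derive x 1 (fun y : R => y ^+ n.+1) (n.+1%:R *: x ^+ n).
  rewrite (_ : (fun y : R => y ^+ n.+1) = (id : R -> R) ^+ n.+1).
    by apply: (is_derive_eq (is_deriveX n.+1 (is_derive_id x 1))); rewrite [LHS]mulr1.
  by apply/funext => y; rewrite exprfctE.
have := is_deriveD IH (is_deriveZ ((n.+1)`!%:R^-1) dX).
rewrite (_ : _ + _ = exp_taylor n.+1 x) // exp_taylorS; congr (_ + _).
rewrite factS natrM /GRing.scale /=.
have n1 : (n.+1%:R : R) != 0 by rewrite pnatr_eq0.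
have n2 : (n`!%:R : R) != 0 by rewrite pnatr_eq0 -lt0n fact_gt0.
move: n1 n2; move: (n.+1%:R) (n`!%:R) => a b a0 b0.
by field; rewrite b0 a0.
Qed.

(** A Taylor polynomial of odd degree lies below the exponential everywhere: the
    derivative of the remainder is the previous remainder, whose sign is that of
    the argument, because its own derivative is a nonnegative remainder. *)
Lemma expR_ge_taylor (R : realType) n (x : R) : exp_taylor n.*2 x <= expR x.
Proof.
suff P m : ~~ odd m -> forall y : R, exp_taylor m y <= expR y.
  by apply: P; rewrite odd_double.
elim: m {-2}m (leqnn m) => [|k IH] m.
  by rewrite leqn0 => /eqP -> _ y; rewrite /exp_taylor big_ord0 expR_ge0.
case: m => [|[//|m]] km om y; first by apply: IH.
pose g j (z : R) : R := expR z - exp_taylor j z.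
have der j (z : R) : is_derive z 1 (g j.+1) (g j z).
  exact: is_deriveB (is_derive_expR z) (is_derive_exp_taylor j z).
have E0 j : g j.+1 0 = 0 by rewrite /g expR0 exp_taylor0 subrr.
suff H z : 0 <= g m.+1 z * (z - 0).
  by have := @le_at_basin R _ _ 0 y (fun u _ => der m.+1 u) (fun u _ => H u);
    rewrite E0 /g subr_ge0.
have gm u : 0 <= g m u.
  rewrite subr_ge0 IH //; first by rewrite -ltnS ltnW.
  by move: om; rewrite /= negbK.
have [z0|/ltW z0] := leP 0 z.
- rewrite subr0 mulr_ge0 // -(E0 m).
  apply: (le_at_basin (fun u _ => der m u)) => u.
  by rewrite min_l // => /andP[u0 _]; rewrite mulr_ge0 // subr_ge0 ltW.
- rewrite subr0 mulr_le0 // -(E0 m).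
  apply: (le_at_basin (fun u _ => der m u)) => u.
  by rewrite min_l // => /andP[u0 _]; rewrite mulr_ge0 // subr_ge0 ltW.
Qed.

Lemma ln_le_taylor (R : realType) n (a t : R) :
  0 < a -> a <= exp_taylor n.*2 t -> ln a <= t.
Proof.
by move=> a0 /le_trans/(_ (expR_ge_taylor n t)); rewrite -{1}(lnK a0) ler_expR.
Qed.

(** Evaluating at [- t] makes a lower bound on the exponential sufficient for
    lower bounds on the logarithm too. *)
Lemma ln_ge_taylor (R : realType) n (a t : R) :
  0 < a -> 1 <= a * exp_taylor n.*2 (- t) -> t <= ln a.
Proof.
move=> a0 H; rewrite -lerN2 -lnV ?posrE //.
apply: (@ln_le_taylor _ n); first by rewrite invr_gt0.
by rewrite -[X in X <= _]mulr1 ler_pdivrMl.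
Qed.

Lemma exp_taylor10E (R : realType) (t : R) : exp_taylor 10 t =
  1 + t * (1 + t / 2 * (1 + t / 3 * (1 + t / 4 * (1 + t / 5 * (1 + t / 6 *
  (1 + t / 7 * (1 + t / 8 * (1 + t / 9)))))))).
Proof.
rewrite /exp_taylor.
(* [c i] is the inverse factorial, known only by its recurrence. *)
have [c [cS c0 ->]] : exists c : nat -> R, [/\ forall k, c k.+1 = k.+1%:R^-1 * c k,
    c 0%N = 1 & \sum_(i < 10) t ^+ i / i`!%:R = \sum_(i < 10) t ^+ i * c i].
  exists (fun k => (k`!%:R)^-1); split => // [k|]; last by rewrite fact0 invr1.
  by rewrite factS natrM invfM.
by rewrite !big_ord_recr big_ord0 /= !cS c0; field.
Qed.

(** * The function [h] *)

(** The numerator of [h x - 3 (x - 1)^2 / (2 (x + 2))] vanishes together with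
    its first derivative at [1], and the sign of that derivative is found by
    differentiating once more. *)
Lemma h_ge_pade (R : realType) (x : R) : 0 <= x ->
  3 * (x - 1) ^+ 2 <= 2 * (x + 2) * h x.
Proof.
rewrite le_eqVlt => /predU1P[<-|x0]; first by rewrite /h mul0r; lra.
have ln_ge (y : R) : 0 < y -> 1 - y^-1 <= ln y.
  move=> y0; have := @le_ln1Dx R (y^-1 - 1).
  rewrite ltrBrDr addNr invr_gt0 y0 => /(_ isT).
  by rewrite addrC subrK lnV ?posrE //; lra.
pose G (y : R) := (y + 1) * ln y - 2 * (y - 1).
have dG (y : R) : 0 < y -> is_derive y 1 G (ln y + y^-1 - 1).
  move=> y0; have dl := is_derive1_ln y0.
  apply: is_derive_eq; rewrite /GRing.scale /=; field; lra.
pose F (y : R) := 2 * (y + 2) * (y * ln y - y + 1) - 3 * (y - 1) ^+ 2.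
have dF (y : R) : 0 < y -> is_derive y 1 F (4 * G y).
  move=> y0; have dl := is_derive1_ln y0.
  apply: is_derive_eq; rewrite /G /GRing.scale /=; field; lra.
have G1 : G 1 = 0 by rewrite /G ln1; lra.
have F1 : F 1 = 0 by rewrite /F ln1; lra.
suff sG y : 0 < y -> 0 <= 4 * G y * (y - 1).
  have := @le_at_basin R F (fun y => 4 * G y) 1 x.
  rewrite F1 /F /h subr_ge0; apply => y /andP[y1 _].
    by apply: dF; apply: lt_le_trans y1; rewrite lt_min ltr01.
  by apply: sG; apply: lt_trans y1; rewrite lt_min ltr01.
move=> y0; have [y1|/ltW y1] := leP 1 y.
- suff : G 1 <= G y by rewrite G1; nra.
  apply: (@le_at_basin R G (fun y => ln y + y^-1 - 1)) => z; rewrite min_l //.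
    by move=> /andP[z1 _]; apply: dG; lra.
  move=> /andP[z1 _]; apply: mulr_ge0; last by rewrite subr_ge0 ltW.
  by have := @ln_ge z ltac:(lra); lra.
- suff : G y <= G 1 by rewrite G1; nra.
  apply: (@le_at_basin R G (fun y => ln y + y^-1 - 1)) => z; rewrite min_l //.
    by move=> /andP[z1 _]; apply: dG; lra.
  move=> /andP[z1 _]; apply: mulr_ge0; last by rewrite subr_ge0 ltW.
  by have := @ln_ge z ltac:(lra); lra.
Qed.

Lemma h_ge0 (R : realType) (x : R) : 0 <= x -> 0 <= h x.
Proof.
move=> x0; have c0 : 0 < 2 * (x + 2) by lra.
rewrite -(pmulr_rge0 _ c0); apply: le_trans (h_ge_pade x0).
by rewrite mulr_ge0 ?sqr_ge0.
Qed.

Lemma h_eq0 (R : realType) (x : R) : 0 <= x -> h x = 0 -> x = 1.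
Proof.
move=> x0 hx; have := h_ge_pade x0; rewrite hx mulr0 => H.
have /eqP : (x - 1) ^+ 2 = 0 by apply/eqP; rewrite eq_le sqr_ge0; lra.
by rewrite sqrf_eq0 subr_eq0 => /eqP.
Qed.

(** Fenchel's inequality for [h]: the minimum over [x] of [h x + t x] is
    attained at [x = exp (- t)]. *)
Lemma h_fenchel (R : realType) (x t : R) : 0 <= x -> 1 - expR (- t) <= h x + t * x.
Proof.
rewrite le_eqVlt => /predU1P[<-|x0].
  by rewrite /h mul0r mulr0; have := expR_gt0 (- t); lra.
have := expR_ge1Dx (- t - ln x); rewrite expRD [expR (- ln x)]expRN (lnK x0) => H.
suff : x * (1 + (- t - ln x)) <= expR (- t) by rewrite /h; lra.
apply: le_trans (ler_wpM2l (ltW x0) H) _.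
by rewrite mulrCA divff ?mulr1 // gt_eqF.
Qed.

(** Second order convexity of [x ln x]: its second derivative [1/x] is convex,
    so the second difference at [m] is at least [d^2/m]. *)
Lemma xlnx_midpoint (R : realType) (m d : R) : 0 < m -> `|d| <= m ->
  2 * m * (m * ln m) + d ^+ 2 <=
  m * ((m + d) * ln (m + d) + (m - d) * ln (m - d)).
Proof.
move=> m0 dm.
pose z := d / m.
have zm : d = z * m by rewrite /z divfK // gt_eqF.
have /andP[z1 z2] : - 1 <= z <= 1.
  by rewrite -ler_norml /z normrM normfV ler_pdivrMr ?mul1r ?normr_gt0 ?gt_eqF // (gtr0_norm m0).
have lnZ (y : R) : 0 <= y -> m * y * ln (m * y) = m * (y * ln m + y * ln y).
  rewrite le_eqVlt => /predU1P[<-|y0]; first by rewrite mulr0 !mul0r addr0 mulr0.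
  by rewrite lnM ?posrE //; ring.
rewrite zm (_ : m + z * m = m * (1 + z)); last ring.
rewrite (_ : m - z * m = m * (1 - z)); last ring.
rewrite !lnZ; try lra.
have := @h_ge_pade R (1 + z) ltac:(lra).
have := @h_ge_pade R (1 - z) ltac:(lra).
rewrite /h.
set A := _ * ln (1 + z); set B := _ * ln (1 - z) => HB HA.
suff: z ^+ 2 <= A + B.
  move=> H; rewrite -subr_ge0.
  rewrite (_ : _ - _ = m ^+ 2 * (A + B - z ^+ 2)); last ring.
  by rewrite mulr_ge0 ?sqr_ge0 // subr_ge0.
have {}HA : 3 * z ^+ 2 <= 2 * (3 + z) * (A - z) by nra.
have {}HB : 3 * z ^+ 2 <= 2 * (3 - z) * (B + z) by nra.
have H : 9 * z ^+ 2 <= (9 - z ^+ 2) * (A + B) by nra.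
have zz : 0 <= z ^+ 2 <= 1 by rewrite sqr_ge0 /=; nra.
move: zz H; move: (z ^+ 2) (A + B) => s t; nra.
Qed.

(** * A pointwise inequality for triangles *)

(** The part of [u v w - 1] of order at least two at [u = v = w = 1]. *)
Definition tri_excess (R : realType) (u v w : R) : R := u * v * w - u - v - w + 2.

Lemma h_midpoint (R : realType) (m d : R) : 0 < m -> `|d| <= m ->
  2 * m * h m + d ^+ 2 <= m * (h (m + d) + h (m - d)).
Proof. by move=> m0 dm; have := xlnx_midpoint m0 dm; rewrite /h; lra. Qed.

(** What remains on the diagonal [u = v = 1 + a] after minimizing over [w] and
    bounding [exp (- t)] by [P^-1]; the inequality has a double zero at [0]. *)
Lemma h_triangle_diag_bound (R : realType) (a t P : R) : 0 <= a <= 23 / 20 ->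
  t = 77 / 100 * (a * (2 + a)) -> P = 1 + t + t ^+ 2 / 2 ->
  154 / 100 * a <= 3 * a ^+ 2 / (3 + a) + 1 - P^-1.
Proof.
move=> /andP[a0 a1] tE PE.
have t0 : 0 <= t by rewrite tE; nra.
have P0 : 0 < P by rewrite PE; nra.
have a3 : 0 < 3 + a by lra.
rewrite -subr_ge0 (_ : _ - _ = (3 * a ^+ 2 * P + (3 + a) * (P - 1 - 154 / 100 * a * P))
   / ((3 + a) * P)); last by field; rewrite !gt_eqF.
apply: divr_ge0; last by rewrite mulr_ge0 // ltW.
pose s : R := 77 / 100 * (2 + a).
rewrite (_ : _ + _ = a ^+ 2 * (3 * P + (3 + a) * (77 / 100 + s ^+ 2 / 2 - 154 / 100 * (s + a * s ^+ 2 / 2)))); last by rewrite PE tE /s; field.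
rewrite mulr_ge0 ?sqr_ge0 // PE tE /s.
(* The remaining quartic is smallest near [a = 8/10]; [H1] and [H2] bound its two
   leading terms below by their tangents there. *)
have H1 : 0 <= (a ^+ 2 - 64 / 100) ^+ 2 by apply: sqr_ge0.
have H2 : 0 <= (a - 8 / 10) ^+ 2 * (a + 16 / 10) by apply: mulr_ge0; [apply: sqr_ge0|lra].
nra.
Qed.

Lemma tri_excess_above (R : realType) (u v w : R) : 1 <= u -> 1 <= v -> 1 <= w ->
  0 <= tri_excess u v w.
Proof.
move=> u1 v1 w1; rewrite /tri_excess.
have H1 : 0 <= (u - 1) * (v - 1) by apply: mulr_ge0; lra.
have H2 : 0 <= (u * v - 1) * (w - 1) by apply: mulr_ge0; nra.
nra.
Qed.

Lemma tri_excess_below (R : realType) (u v w : R) : 0 <= u <= 1 -> 0 <= v <= 1 ->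
  0 <= w <= 1 -> 0 <= tri_excess u v w.
Proof.
move=> /andP[u0 u1] /andP[v0 v1] /andP[w0 w1]; rewrite /tri_excess.
have H1 : 0 <= (1 - u) * (1 - v) by apply: mulr_ge0; lra.
have H2 : 0 <= (1 - u * v) * (1 - w) by apply: mulr_ge0; nra.
nra.
Qed.

(** On the diagonal [u = v = m], minimizing over [w] by Fenchel's inequality
    leaves an inequality in [m] alone. *)
Lemma h_triangle_ge0_diag (R : realType) (m w : R) : 1 <= m <= 215 / 100 -> 0 <= w ->
  0 <= 2 * h m + h w + 77 / 100 * tri_excess m m w.
Proof.
move=> /andP[m1 m2] w0.
pose a := m - 1; pose t := 77 / 100 * (a * (2 + a)).
have a0 : 0 <= a by rewrite /a; lra.
have a1 : a <= 23 / 20 by rewrite /a; lra.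
have t0 : 0 <= t by rewrite /t; nra.
have Hw := h_fenchel t w0.
have tE : t = 77 / 100 * (m * m - 1) by rewrite /t /a; ring.
have Hm : 3 * a ^+ 2 / (3 + a) <= 2 * h m.
  have := @h_ge_pade R m ltac:(lra).
  rewrite (_ : m - 1 = a) // (_ : m + 2 = 3 + a); last by rewrite /a; ring.
  by rewrite ler_pdivrMr; [lra|lra].
have He : expR (- t) <= (1 + t + t ^+ 2 / 2)^-1.
  rewrite expRN lef_pV2 ?posrE ?expR_gt0 //; last by nra.
  have -> : 1 + t + t ^+ 2 / 2 = exp_taylor 3 t.
    by rewrite /exp_taylor !big_ord_recr big_ord0 /= expr0 expr1 add0r !divr1.
  apply: le_trans (expR_ge_taylor 2 t); rewrite [2.*2]/= (exp_taylorS 3) lerDl.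
  by rewrite divr_ge0 // exprn_ge0.
have := @h_triangle_diag_bound R a t _ _ (erefl _) (erefl _).
rewrite a0 a1 => /(_ isT) Hp.
have aE : a = m - 1 by [].
have {}Hw : 1 - expR (- t) <= h w + 77 / 100 * (m * m - 1) * w by rewrite -tE.
have {}Hp := le_trans Hp (lerB (lerD Hm (lexx 1)) He).
rewrite /tri_excess; lra.
Qed.

(** If one argument is small, the expression is minimal when the other two are
    equal: replacing them by their mean [m] gains [(1/m - 77/100 w) d^2]. *)
Lemma h_triangle_ge0_small (R : realType) (u v w : R) :
  0 <= u <= 215 / 100 -> 0 <= v <= 215 / 100 -> 0 <= w <= 6 / 10 ->
  0 <= h u + h v + h w + 77 / 100 * tri_excess u v w.
Proof.
move=> /andP[u0 u1] /andP[v0 v1] /andP[w0 w1].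
pose m := (u + v) / 2; pose d := (u - v) / 2.
have uE : u = m + d by rewrite /m /d; field.
have vE : v = m - d by rewrite /m /d; field.
have m0 : 0 <= m by rewrite /m; lra.
have m2 : m <= 215 / 100 by rewrite /m; lra.
have [mz|mz] := eqVneq m 0.
  have u00 : u = 0 by move: mz; rewrite /m; lra.
  have v00 : v = 0 by move: mz; rewrite /m; lra.
  have H : 0 <= tri_excess 0 0 w by apply: tri_excess_below; lra.
  by rewrite u00 v00; have := h_ge0 (lexx 0 : 0 <= 0 :> R); have := h_ge0 w0; lra.
have {mz}m0 : 0 < m by rewrite lt_neqAle eq_sym mz.
have dm : `|d| <= m by rewrite ler_norml /d /m; apply/andP; split; lra.
have Hmid := h_midpoint m0 dm.
have -> : tri_excess u v w = tri_excess m m w - d ^+ 2 * w.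
  by rewrite /tri_excess uE vE; ring.
have Hd : 77 / 100 * (d ^+ 2 * w) <= d ^+ 2 / m.
  rewrite ler_pdivlMr // (_ : _ * m = d ^+ 2 * (77 / 100 * (w * m))); last ring.
  rewrite ler_piMr ?sqr_ge0 //.
  have : w * m <= 6 / 10 * (215 / 100) by apply: ler_pM; rewrite ?(ltW m0).
  by lra.
have {}Hmid : 2 * h m + d ^+ 2 / m <= h u + h v.
  rewrite -(ler_pM2l m0) uE vE; apply: le_trans Hmid.
  by rewrite mulrDr [m * (_ / _)]mulrC divfK ?gt_eqF //; lra.
have : 0 <= 2 * h m + h w + 77 / 100 * tri_excess m m w.
  have [m1|/ltW m1] := leP 1 m; first by apply: h_triangle_ge0_diag => //; rewrite m1.
  have H : 0 <= tri_excess m m w by apply: tri_excess_below; lra.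
  by have := h_ge0 (ltW m0); have := h_ge0 w0; lra.
lra.
Qed.

(** [36/100] is less than [3 / (2 (u + 2))] at [u = 215/100]. *)
Lemma h_ge_quad (R : realType) (u : R) : 0 <= u <= 215 / 100 ->
  36 / 100 * (u - 1) ^+ 2 <= h u.
Proof.
move=> /andP[u0 u1]; have := h_ge_pade u0.
by have := h_ge0 u0; have := sqr_ge0 (u - 1); move: ((u - 1) ^+ 2) (h u) => s t; nra.
Qed.

Lemma h_ge_cubic (R : realType) (w : R) : 0 <= w <= 1 ->
  (1 - w) ^+ 2 / 2 + (1 - w) ^+ 3 / 6 <= h w.
Proof.
move=> /andP[w0 w1]; have := h_ge_pade w0.
have -> : (w - 1) ^+ 2 = (1 - w) ^+ 2 by ring.
pose g := 1 - w; have -> : w = 1 - g by rewrite /g; ring.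
rewrite subKr.
have g0 : 0 <= g <= 1 by rewrite /g; lra.
move: g0 (h _) => /andP[g0 g1] t H.
have c0 : 0 < 2 * (1 - g + 2) by lra.
rewrite -(ler_pM2l c0); apply: le_trans H.
by have := exprn_ge0 4 g0; nra.
Qed.

Lemma quad_form_ge0 (R : realType) (A B C s g : R) : 0 < A -> B ^+ 2 <= 4 * A * C ->
  0 <= A * s ^+ 2 - B * g * s + C * g ^+ 2.
Proof.
move=> A0 H; have A4 : 0 < 4 * A by lra.
rewrite -(pmulr_rge0 _ A4).
rewrite (_ : 4 * A * _ = (2 * A * s - B * g) ^+ 2 + (4 * A * C - B ^+ 2) * g ^+ 2); last ring.
apply: addr_ge0; first exact: sqr_ge0.
by apply: mulr_ge0; rewrite ?sqr_ge0 // subr_ge0.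
Qed.

(** When no argument is small, polynomial lower bounds for [h] leave positive
    quadratic forms in the distances to [1]. *)
Lemma h_triangle_ge0_mid (R : realType) (u v w : R) :
  1 <= u <= 215 / 100 -> w <= v <= 215 / 100 -> 6 / 10 <= w <= 1 ->
  0 <= h u + h v + h w + 77 / 100 * tri_excess u v w.
Proof.
move=> /andP[u0 u1] /andP[v0 v1] /andP[w0 w1].
pose a := u - 1; pose g := 1 - w.
have -> : tri_excess u v w = a * (v - 1) * w - g * (a + v - 1).
  by rewrite /tri_excess /a /g; ring.
have Hu := @h_ge_quad R u ltac:(lra).
have Hw := @h_ge_cubic R w ltac:(lra).
have [v2|/ltW v2] := leP 1 v.
- have Hv := @h_ge_quad R v ltac:(lra).
  pose b := v - 1.
  have [a0 b0 g0 g1] : [/\ 0 <= a, 0 <= b, 0 <= g & g <= 4 / 10].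
    by rewrite /a /b /g; split; lra.
  have ab : 0 <= a * b by rewrite mulr_ge0.
  have ab4 : a * b <= (a + b) ^+ 2 / 4.
    by have := sqr_ge0 (a - b); rewrite ler_pdivlMr //; lra.
  have g3 : 0 <= g ^+ 3 by rewrite exprn_ge0.
  move: Hu Hv Hw; rewrite -/a -/b -/g (_ : w = 1 - g); last by rewrite /g; ring.
  rewrite (_ : a + v - 1 = a + b); last by rewrite /b; ring.
  suff : 0 <= 36 / 100 * (a ^+ 2 + b ^+ 2) + 77 / 100 * (a * b * (1 - g))
      - 77 / 100 * g * (a + b) + (g ^+ 2 / 2 + g ^+ 3 / 6) by lra.
  (* For a given sum [a + b] the form is affine in [a b], which lies between [0]
     and [(a + b)^2 / 4]; the sign of its slope selects the worse end. *)
  have [k0|/ltW k0] := leP 0 (77 / 100 * (1 - g) - 72 / 100).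
  + have := @quad_form_ge0 R (36 / 100) (77 / 100) (1 / 2) (a + b) g ltac:(lra) ltac:(lra).
    by have := mulr_ge0 ab k0; lra.
  + have := @quad_form_ge0 R (149 / 400 - 77 / 400 * g) (77 / 100)
      (1 / 2 + g / 6) (a + b) g ltac:(lra) ltac:(nra).
    have : 0 <= ((a + b) ^+ 2 / 4 - a * b) * (72 / 100 - 77 / 100 * (1 - g)).
      by rewrite mulr_ge0; lra.
    lra.
- have Hv := @h_ge_cubic R v ltac:(lra).
  pose b := 1 - v.
  have [a0 b0 g0] : [/\ 0 <= a, 0 <= b & 0 <= g] by rewrite /a /b /g; split; lra.
  have g3 : 0 <= g ^+ 3 by rewrite exprn_ge0.
  have b3 : 0 <= b ^+ 3 by rewrite exprn_ge0.
  have abg : 0 <= a * b * g by rewrite !mulr_ge0.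
  move: Hu Hv Hw; rewrite -/a -/b -/g (_ : w = 1 - g); last by rewrite /g; ring.
  rewrite (_ : a + v - 1 = a - b); last by rewrite /b; ring.
  rewrite (_ : v - 1 = - b); last by rewrite /b; ring.
  have := @quad_form_ge0 R (36 / 100) (77 / 100) (177 / 400) a (b + g)
    ltac:(lra) ltac:(lra).
  by have := sqr_ge0 (b - g); lra.
Qed.

(** The constants leave room for the application: [1000/466 < 215/100] and
    [ln (1000/466) < 77/100].  The three regimes depend on the least argument. *)
Lemma h_triangle_ge0 (R : realType) (u v w : R) :
  0 <= u <= 215 / 100 -> 0 <= v <= 215 / 100 -> 0 <= w <= 215 / 100 ->
  0 <= h u + h v + h w + 77 / 100 * tri_excess u v w.
Proof.
have step (x y z : R) : 0 <= z -> z <= y -> y <= x -> x <= 215 / 100 ->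
    0 <= h x + h y + h z + 77 / 100 * tri_excess x y z.
  move=> z0 zy yx x2.
  have hx := @h_ge0 R x ltac:(lra); have hy := @h_ge0 R y ltac:(lra).
  have hz := h_ge0 z0.
  have [z6|/ltW z6] := leP z (6 / 10); first by apply: h_triangle_ge0_small; lra.
  have [x1|/ltW x1] := leP x 1.
    have H : 0 <= tri_excess x y z by apply: tri_excess_below; lra.
    lra.
  have [z1|/ltW z1] := leP z 1; first by apply: h_triangle_ge0_mid; lra.
  have H : 0 <= tri_excess x y z by apply: tri_excess_above; lra.
  lra.
move=> /andP[u0 u1] /andP[v0 v1] /andP[w0 w1].
have C1 : tri_excess v u w = tri_excess u v w by rewrite /tri_excess; ring.
have C2 : tri_excess u w v = tri_excess u v w by rewrite /tri_excess; ring.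
have C3 : tri_excess v w u = tri_excess u v w by rewrite /tri_excess; ring.
have C4 : tri_excess w u v = tri_excess u v w by rewrite /tri_excess; ring.
have C5 : tri_excess w v u = tri_excess u v w by rewrite /tri_excess; ring.
have [uv|/ltW uv] := leP u v; have [vw|/ltW vw] := leP v w;
  have [uw|/ltW uw] := leP u w.
all: [> have := step w v u | have := step w v u | have := step v w u
  | have := step v u w | have := step w u v | have := step u w v
  | have := step u v w | have := step u v w ].
all: rewrite ?C1 ?C2 ?C3 ?C4 ?C5; lra.
Qed.

(** * Relative entropy *)

Lemma h_scale (R : realType) (x y : R) : y != 0 ->
  y * h (x / y) = x * ln (x / y) - x + y.
Proof.
move=> y0; rewrite /h !mulrDr mulr1 mulrN [y * (x / y)]mulrC divfK //.
by rewrite mulrA [y * (x / y)]mulrC divfK.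
Qed.

Lemma rel_entropyE (R : realType) (q a : R) : 0 < q < 1 ->
  rel_entropy q a = q * h (a / q) + (1 - q) * h ((1 - a) / (1 - q)).
Proof.
by move=> /andP[q0 q1]; rewrite !h_scale ?subr_eq0 ?gt_eqF // /rel_entropy; ring.
Qed.

Lemma rel_entropy_ge (R : realType) (q a : R) : 0 < q < 1 -> a <= 1 ->
  q * h (a / q) <= rel_entropy q a.
Proof.
move=> q01 a1; rewrite rel_entropyE // lerDl; move: q01 => /andP[q0 q1].
by rewrite mulr_ge0 ?h_ge0 ?divr_ge0 //; lra.
Qed.

Lemma rel_entropy_ge0 (R : realType) (q a : R) : 0 < q < 1 -> 0 <= a <= 1 ->
  0 <= rel_entropy q a.
Proof.
move=> q01 /andP[a0 a1]; apply: le_trans (rel_entropy_ge q01 a1).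
by move: q01 => /andP[q0 q1]; rewrite mulr_ge0 ?h_ge0 ?divr_ge0 // ltW.
Qed.

Lemma rel_entropyxx (R : realType) (p : R) : 0 < p < 1 -> rel_entropy p p = 0.
Proof.
by move=> /andP[p0 p1]; rewrite /rel_entropy !divff ?subr_eq0 ?gt_eqF // ln1; lra.
Qed.

(** [tilt p q] is minus the derivative at [q] of the relative entropy to [p];
    the remainder of the tangent line is the relative entropy to [q]. *)
Definition tilt (R : realType) (p q : R) : R :=
  ln (p / q) + ln ((1 - q) / (1 - p)).

Lemma tilt_ge0 (R : realType) (p q : R) :
  0 < p < 1 -> 0 < q -> q <= p -> 0 <= tilt p q.
Proof.
move=> /andP[p0 p1] q0 qp; rewrite addr_ge0 // ln_ge0 // ler_pdivlMr ?subr_gt0 //.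
  by rewrite mul1r.
by rewrite mul1r lerD2l lerN2.
Qed.

Lemma rel_entropy_tangent (R : realType) (p q a : R) :
  0 < p < 1 -> 0 < q < 1 -> 0 <= a <= 1 ->
  rel_entropy p a = rel_entropy p q - tilt p q * (a - q) + rel_entropy q a.
Proof.
move=> /andP[p0 p1] /andP[q0 q1] /andP[a0 a1].
have lnE (x y : R) : 0 < y -> 0 <= x -> x * ln (x / y) = x * (ln x - ln y).
  move=> y0; rewrite le_eqVlt => /predU1P[<-|x0]; first by rewrite !mul0r.
  by rewrite ln_div ?posrE.
rewrite /rel_entropy /tilt !lnE ?ln_div ?posrE; lra.
Qed.

(** The tangent line at [q] reduces the claim to [h_triangle_ge0]: once scaled by
    [q], the linear terms of the three tangents combine with the cubic term
    into [tri_excess].  The factor [1/770] is [1 - (769/1000) / (77/100)], the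
    share of [h u + h v + h w] left over when [tilt p q <= 769/1000]. *)
Lemma rel_entropy_triple_below (R : realType) (p q a b c : R) :
  0 < p < 1 -> q < p -> 466 / 1000 * p < q -> tilt p q <= 769 / 1000 ->
  0 <= a <= p -> 0 <= b <= p -> 0 <= c <= p ->
  3 * rel_entropy p q + tilt p q * q
    + q / 770 * (h (a / q) + h (b / q) + h (c / q)) <=
  rel_entropy p a + rel_entropy p b + rel_entropy p c
    + tilt p q / q ^+ 2 * (a * b * c).
Proof.
move=> p01 qp pq t1 a0 b0 c0.
have /andP[p0 p1] := p01.
have q0 : 0 < q by lra.
have q01 : 0 < q < 1 by rewrite q0; lra.
have t0 := tilt_ge0 p01 q0 (ltW qp).
have scaled x : 0 <= x <= p -> 0 <= x / q <= 215 / 100.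
  by move=> /andP[x0 xp]; rewrite divr_ge0 ?ler_pdivrMr //=; lra.
have tangent x : 0 <= x <= p ->
    rel_entropy p q - tilt p q * (x - q) + q * h (x / q) <= rel_entropy p x.
  move=> /andP[x0 xp]; rewrite (@rel_entropy_tangent _ p q x) //; last lra.
  by rewrite lerD2l rel_entropy_ge //; lra.
have := h_triangle_ge0 (scaled _ a0) (scaled _ b0) (scaled _ c0).
have := tangent _ a0; have := tangent _ b0; have := tangent _ c0.
have := h_ge0 (proj1 (andP (scaled _ a0))).
have := h_ge0 (proj1 (andP (scaled _ b0))).
have := h_ge0 (proj1 (andP (scaled _ c0))).
have -> : tilt p q / q ^+ 2 * (a * b * c) =
    tilt p q * q * (a / q * (b / q) * (c / q)) by field; rewrite gt_eqF.
have unscale x : x - q = q * (x / q - 1).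
  by rewrite mulrBr mulr1 mulrC divfK // gt_eqF.
rewrite !unscale /tri_excess; move: (a / q) (b / q) (c / q) => u v w.
move: (tilt p q) t0 t1 => t t0 t1 hw hv hu Ic Ib Ia core.
have tS : 0 <= t * (h u + h v + h w + 77 / 100 * (u * v * w - u - v - w + 2)).
  exact: mulr_ge0.
have S0 : 0 <= (h u + h v + h w) * (769 / 1000 - t).
  by rewrite mulr_ge0 ?subr_ge0 //; exact: addr_ge0 (addr_ge0 hu hv) hw.
suff : 0 <= q * ((h u + h v + h w) * (769 / 770) + t * (u * v * w - u - v - w + 2)).
  clear -Ia Ib Ic; lra.
apply: mulr_ge0; first exact: ltW.
by clear -tS S0; lra.
Qed.

(** Lowering to [p] the edge weights above [p] decreases the right-hand side,
    because the relative entropy vanishes at [p]. *)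
Lemma rel_entropy_triple (R : realType) (p q a b c : R) :
  0 < p < 1 -> q < p -> 466 / 1000 * p < q -> tilt p q <= 769 / 1000 ->
  0 <= a <= 1 -> 0 <= b <= 1 -> 0 <= c <= 1 ->
  3 * rel_entropy p q + tilt p q * q + q / 770 *
    (h (Num.min a p / q) + h (Num.min b p / q) + h (Num.min c p / q)) <=
  rel_entropy p a + rel_entropy p b + rel_entropy p c
    + tilt p q / q ^+ 2 * (a * b * c).
Proof.
move=> p01 qp pq t1 a0 b0 c0; have /andP[p0 p1] := p01.
have q0 : 0 < q by lra.
have t0 := tilt_ge0 p01 q0 (ltW qp).
have low x : 0 <= x <= 1 -> 0 <= Num.min x p <= p.
  by move=> /andP[x0 _]; rewrite le_min x0 ge_min lexx orbT (ltW p0).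
have low_le x : Num.min x p <= x by rewrite ge_min lexx.
have lowI x : 0 <= x <= 1 -> rel_entropy p (Num.min x p) <= rel_entropy p x.
  move=> x01; have [xp|px] := leP x p; rewrite ?lexx //.
  by rewrite rel_entropyxx // rel_entropy_ge0.
apply: le_trans (rel_entropy_triple_below p01 qp pq t1 (low _ a0) (low _ b0) (low _ c0)) _.
apply: lerD; first exact: lerD (lerD (lowI _ a0) (lowI _ b0)) (lowI _ c0).
have /andP[a1 _] := low _ a0; have /andP[b1 _] := low _ b0.
have /andP[c1 _] := low _ c0.
rewrite ler_wpM2l ?divr_ge0 ?exprn_ge0 ?(ltW q0) //.
by rewrite !ler_pM ?mulr_ge0.
Qed.

(** The first logarithm is less than [ln (1000/466) < 764/1000], and the second is
    of order [p]. *)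
Lemma tilt_le (R : realType) (p q : R) :
  0 < p <= 1 / 250 -> q < p -> 466 / 1000 * p < q -> tilt p q <= 769 / 1000.
Proof.
move=> /andP[p0 p1] qp pq; have q0 : 0 < q by lra.
have p1' : p < 1 by lra.
have L1 : ln (p / q) <= 764 / 1000.
  apply: (@ln_le_taylor _ 5); first by rewrite divr_gt0.
  by rewrite ler_pdivrMr // exp_taylor10E; clear -p0 pq; lra.
have L2 : ln ((1 - q) / (1 - p)) <= (p - q) / (1 - p).
  have -> : (1 - q) / (1 - p) = 1 + (p - q) / (1 - p).
    by field; rewrite gt_eqF // subr_gt0.
  apply: le_ln1Dx; apply: (lt_le_trans (ltrN10 R)).
  by rewrite divr_ge0 // subr_ge0 ltW.
have L3 : (p - q) / (1 - p) <= 5 / 1000.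
  by rewrite ler_pdivrMr ?subr_gt0 //; clear -p1 p0 q0; lra.
by rewrite /tilt; clear -L1 L2 L3; lra.
Qed.

(** * The constant [rbar] *)

(** Strict, because [x h (y / x)] is the gap and [h] vanishes only at [1]. *)
Lemma xlnx_gt_tangent (R : realType) (x y : R) : 0 < x -> 0 < y -> y != x ->
  x * ln x + (1 + ln x) * (y - x) < y * ln y.
Proof.
move=> x0 y0 yx; have xn : x != 0 by rewrite gt_eqF.
have := h_ge0 (divr_ge0 (ltW y0) (ltW x0)); rewrite le_eqVlt => /predU1P[H|].
  have := h_eq0 (divr_ge0 (ltW y0) (ltW x0)) (esym H).
  by move/(congr1 ( *%R^~ x)); rewrite divfK // mul1r => /eqP; rewrite (negPf yx).
rewrite -(pmulr_rgt0 _ x0) /h ln_div ?posrE // => H.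
rewrite -subr_gt0; apply: lt_le_trans H _; rewrite le_eqVlt; apply/orP; left.
by apply/eqP; field.
Qed.

(** [3/2 r ln r - r + 1] is strictly convex and vanishes at [1], hence has at
    most one other zero. *)
Lemma rbar_unique (R : realType) (r s : R) :
  0 < r < 1 -> 3 / 2 * r * ln r - r + 1 = 0 ->
  0 < s < 1 -> 3 / 2 * s * ln s - s + 1 = 0 -> r = s.
Proof.
have no (x y : R) : 0 < x -> x < y -> y < 1 ->
    3 / 2 * x * ln x - x + 1 = 0 -> 3 / 2 * y * ln y - y + 1 = 0 -> False.
  move=> x0 xy y1 Hx Hy; have y0 : 0 < y by lra.
  have := @xlnx_gt_tangent R y x y0 x0 ltac:(by rewrite lt_eqF).
  have := @xlnx_gt_tangent R y 1 y0 ltac:(lra) ltac:(by rewrite gt_eqF).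
  rewrite ln1; move: Hx Hy; move: (ln x) (ln y) => lx ly; nra.
move=> /andP[r0 r1] Hr /andP[s0 s1] Hs.
by case: (ltgtP r s) => // ?; exfalso; [apply: (no r s)|apply: (no s r)].
Qed.

Lemma rbar_exists (R : realType) :
  exists2 r : R, 466 / 1000 <= r < 467 / 1000 & 3 / 2 * r * ln r - r + 1 = 0.
Proof.
pose g (r : R) := 3 / 2 * r * ln r - r + 1.
have dg (r : R) : 0 < r -> is_derive r 1 g (3 / 2 * (ln r + 1) - 1).
  move=> r0; have dl := is_derive1_ln r0.
  apply: is_derive_eq; rewrite /GRing.scale /=; field; lra.
have cg (a b : R) : 0 < a -> {within `[a, b], continuous g}.
  move=> a0; apply: derivable_within_continuous => x.
  by rewrite in_itv /= => /andP[x1 _]; have [] := dg x (lt_le_trans a0 x1).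
have g1 : 0 <= g (466 / 1000).
  have : ln (466 / 1000 : R) >= - 239 / 313.
    by apply: (@ln_ge_taylor _ 5); [lra|rewrite exp_taylor10E; lra].
  by rewrite /g; lra.
have g2 : g (467 / 1000) < 0.
  have : ln (467 / 1000 : R) <= - 67 / 88.
    by apply: (@ln_le_taylor _ 5); [lra|rewrite exp_taylor10E; lra].
  by rewrite /g; lra.
have [||| r] := @IVT R g (466 / 1000) (467 / 1000) 0.
- lra.
- by apply: cg; lra.
- by rewrite ge_min le_max g1 (ltW g2) orbT.
rewrite in_itv /= => /andP[r1 r2] gr; exists r => //.
rewrite r1 /= lt_neqAle r2 andbT; apply/eqP => E.
by move: g2; rewrite -E gr ltxx.
Qed.

(** * The curve of two-block graphons of a given triangle density *)

(** Halving the exponent before applying the Taylor polynomial makes a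
    polynomial of degree 9 accurate enough. *)
Lemma ln_le_taylor_sqr (R : realType) (a t : R) :
  0 < a -> 0 <= exp_taylor 10 (t / 2) -> a <= exp_taylor 10 (t / 2) ^+ 2 -> ln a <= t.
Proof.
move=> a0 T0 aT; rewrite -ler_expR (lnK a0); apply: le_trans aT _.
rewrite (_ : expR t = expR (t / 2) ^+ 2); last by rewrite -expRM_natl; congr expR; field.
by rewrite lerXn2r ?nnegrE ?expR_ge0 // (expR_ge_taylor 5).
Qed.

Lemma ln_ge_taylor_sqr (R : realType) (a t : R) : 0 < a ->
  0 <= exp_taylor 10 (- t / 2) -> 1 <= a * exp_taylor 10 (- t / 2) ^+ 2 -> t <= ln a.
Proof.
move=> a0 T0 H; rewrite -lerN2 -lnV ?posrE //.
apply: ln_le_taylor_sqr; rewrite ?invr_gt0 //.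
by rewrite -[X in X <= _]mulr1 ler_pdivrMl.
Qed.

(** For a two-block graphon with value [u] on the diagonal blocks and
    triangle density [1], [f_other 1 u] is the value on the other blocks. *)
Lemma f_otherM (R : realType) (r u : R) : 0 < r -> 0 < u ->
  f_other r (r * u) = r * f_other 1 u.
Proof.
move=> r0 u0; rewrite /f_other expr1n mulr1.
rewrite (_ : (_ - _) / _ = r ^+ 2 * ((4 - u ^+ 3) / (3 * u))).
  by rewrite sqrtrM ?sqr_ge0 // sqrtr_sqr gtr0_norm.
by field; rewrite !gt_eqF.
Qed.

Lemma f_other1_sqr (R : realType) (u : R) : 0 < u < 1 ->
  f_other 1 u ^+ 2 = (4 - u ^+ 3) / (3 * u).
Proof.
move=> /andP[u0 u1]; rewrite /f_other expr1n mulr1 sqr_sqrtr //.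
have u3 : u ^+ 3 <= 1 by rewrite exprn_ile1 // ltW.
by rewrite divr_ge0; lra.
Qed.

Lemma f_other1_eq (R : realType) (u : R) : 0 < u < 1 ->
  u ^+ 3 + 3 * u * f_other 1 u ^+ 2 = 4.
Proof.
by move=> /[dup] /andP[u0 _] /f_other1_sqr ->; field; rewrite gt_eqF.
Qed.

Lemma f_other1_gt1 (R : realType) (u : R) : 0 < u < 1 -> 1 < f_other 1 u.
Proof.
move=> /[dup] /f_other1_sqr E /andP[u0 u1].
rewrite -(@ltr_pXn2r _ 2) ?nnegrE ?sqrtr_ge0 // expr1n E ltr_pdivlMr; last lra.
have : u ^+ 3 <= u by rewrite -[X in _ <= X]expr1 ler_wiXn2l // ltW.
by lra.
Qed.

Definition curve_mean (R : realType) (u : R) : R := (u + f_other 1 u) / 2.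

Definition curve_xlnx (R : realType) (u : R) : R :=
  (u * ln u + f_other 1 u * ln (f_other 1 u)) / 2.

(** The mean [d] and half-difference [e] of the two values satisfy
    [d^3 - e^3 = 1]. *)
Lemma curve_mean_gt1 (R : realType) (u : R) : 0 < u < 1 -> 1 < curve_mean u.
Proof.
move=> u01; have := f_other1_eq u01; have := f_other1_gt1 u01.
move: u01 => /andP[u0 u1]; rewrite /curve_mean; move: (f_other 1 u) => v v1 E.
pose d := (u + v) / 2; pose e := (v - u) / 2.
have e0 : 0 < e by rewrite /e; lra.
have d0 : 0 < d by rewrite /d; lra.
have : d ^+ 3 = 1 + e ^+ 3.
  have -> : 1 = (u ^+ 3 + 3 * u * v ^+ 2) / 4 by rewrite E divff.
  by rewrite /d /e; field.
move=> dE; rewrite -/d ltNge; apply/negP => d1.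
have : d ^+ 3 <= 1 by rewrite exprn_ile1 // ltW.
by rewrite dE; have := exprn_gt0 3 e0; lra.
Qed.

(** [rho u] is the only [r] for which the point [r u] is a zero of [f r],
    because [f r (r u) / r] is affine in [ln r]. *)
Definition rho (R : realType) (u : R) : R :=
  expR (1 - curve_xlnx u / (curve_mean u - 1)).

Lemma f_scale (R : realType) (r u : R) : 0 < r -> 0 < u < 1 ->
  f r (r * u) = r * (ln r * (curve_mean u - 1) + curve_xlnx u - (curve_mean u - 1)).
Proof.
move=> r0 u01; have v1 := f_other1_gt1 u01; have /andP[u0 u1] := u01.
rewrite /f f_otherM // /h !lnM ?posrE //; last lra.
by rewrite /curve_mean /curve_xlnx; field.
Qed.

Lemma f_eq0E (R : realType) (r u : R) : 0 < r -> 0 < u < 1 ->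
  f r (r * u) = 0 <-> r = rho u.
Proof.
move=> r0 u01; have m1 := curve_mean_gt1 u01; rewrite f_scale //.
have m0 : curve_mean u - 1 != 0 by rewrite subr_eq0 gt_eqF.
have rE : r = expR (ln r) by rewrite (lnK r0).
split.
- move/eqP; rewrite mulf_eq0 gt_eqF //= => /eqP E.
  rewrite {1}rE /rho; congr expR; apply: (mulIf m0).
  by rewrite mulrBl divfK //; lra.
- move=> /(congr1 (@ln R)); rewrite /rho expRK => ->.
  by rewrite mulrBl divfK // mul1r; ring.
Qed.

Lemma f_has_zeroE (R : realType) (r : R) : 0 < r < 1 ->
  f_has_zero r <-> exists2 u, 0 < u < 1 & r = rho u /\ r * f_other 1 u <= 1.
Proof.
move=> /[dup] r01 /andP[r0 r1]; split.
- move=> [_ [x [[_ y1] /andP[x0 xr] fx]]].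
  have xE : x = r * (x / r) by rewrite mulrC divfK // gt_eqF.
  have u01 : 0 < x / r < 1 by rewrite divr_gt0 //= ltr_pdivrMr // mul1r.
  exists (x / r) => //; split; first by apply/f_eq0E => //; rewrite -xE.
  by rewrite -f_otherM ?divr_gt0 // -xE.
- move=> [u /[dup] u01 /andP[u0 u1] [rE y1]]; split => //.
  exists (r * u); split; last exact/f_eq0E.
  + split; last by rewrite f_otherM.
    by rewrite mulr_gt0 //= ler_piMr // ltW.
  + by rewrite mulr_gt0 //= gtr_pMr.
Qed.

Lemma rho_lt (R : realType) (u c b : R) : 0 < u < 1 -> 0 < b -> 1 - c <= ln b ->
  c * (curve_mean u - 1) < curve_xlnx u -> rho u < b.
Proof.
move=> u01 b0 cb H; have := curve_mean_gt1 u01; rewrite -subr_gt0 => m0.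
rewrite -(lnK b0) /rho ltr_expR; apply: lt_le_trans cb.
by rewrite ltrD2l ltrN2 ltr_pdivlMr.
Qed.

(** Near the diagonal the second order term [e^2 / (2 d)] of [x ln x] beats
    the gain [d - 1 <= e^3 / 3] in the mean. *)
Lemma rho_near (R : realType) (u : R) : 34 / 100 <= u < 1 -> rho u < 209 / 1000.
Proof.
move=> /andP[u0 u1]; have u01 : 0 < u < 1 by rewrite u1 andbT; lra.
have L : 1 - 257 / 100 <= ln (209 / 1000 : R).
  by apply: (@ln_ge_taylor _ 5); [lra|rewrite exp_taylor10E; lra].
apply: (rho_lt u01 _ L); first lra.
have := f_other1_eq u01; have := f_other1_gt1 u01; have := curve_mean_gt1 u01.
rewrite /curve_mean /curve_xlnx; move: (f_other 1 u) => v.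
pose d := (u + v) / 2; pose e := (v - u) / 2; rewrite -/d => d1 v1 E.
have e0 : 0 < e by rewrite /e; lra.
have de : `|e| <= d by rewrite ler_norml /d /e; lra.
have dE : d ^+ 3 - e ^+ 3 = 1.
  have -> : 1 = (u ^+ 3 + 3 * u * v ^+ 2) / 4 by rewrite E divff.
  by rewrite /d /e; field.
have ed : e * d <= 955 / 1000.
  have : v ^+ 2 - u ^+ 2 <= 382 / 100.
    have uu : 34 / 100 * u <= u * u by nra.
    have : u * (v ^+ 2 - u ^+ 2) <= u * (382 / 100) by nra.
    by rewrite ler_pM2l //; lra.
  by rewrite /e /d; lra.
have d0 : 0 < d by lra.
have := xlnx_midpoint d0 de.
have -> : d + e = v by rewrite /d /e; field.
have -> : d - e = u by rewrite /d /e; field.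
have := h_ge0 (ltW d0); rewrite /h => hd.
rewrite [v * ln v + _]addrC; move: (u * ln u + v * ln v) => K HK.
have d3 : 3 * (d - 1) <= e ^+ 3.
  have : 0 <= (d - 1) ^+ 2 * (d + 2) by rewrite mulr_ge0 ?sqr_ge0; lra.
  by nra.
have e2 : 0 < e ^+ 2 by rewrite exprn_gt0.
have H1 : 3 * (d - 1) * d <= 955 / 1000 * e ^+ 2.
  have : e ^+ 3 * d <= 955 / 1000 * e ^+ 2.
    rewrite (_ : e ^+ 3 * d = e * d * e ^+ 2); last ring.
    by rewrite ler_pM2r.
  by apply: le_trans; rewrite ler_pM2r.
have H2 : d * (2 * (d - 1)) <= d * (d * ln d * 2) by rewrite ler_pM2l //; lra.
rewrite -(ltr_pM2l d0) -subr_gt0.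
have : 2 * d * (d - 1) + e ^+ 2 <= d * K by lra.
lra.
Qed.

Lemma xlnx_ge_line (R : realType) (x a la : R) : 0 < x -> 0 < a -> la <= ln a ->
  x * (1 + la) - a <= x * ln x.
Proof.
move=> x0 a0 aL; have := h_ge0 (divr_ge0 (ltW x0) (ltW a0)).
rewrite -(pmulr_rge0 _ a0) h_scale ?gt_eqF // ln_div ?posrE // => H.
have : x * la <= x * ln a by rewrite ler_pM2l.
by lra.
Qed.

(** With [x ln x] bounded below by its tangents at [a] and [b], the inequality
    [c (d - 1) < curve_xlnx u] becomes a linear condition on [u] and
    [f_other 1 u], hence a cubic one on [u]. *)
Lemma rho_lt_tangent (R : realType) (u c s a b la lb : R) : 0 < u < 1 ->
  0 < s -> 1 - c <= ln s -> 0 < a -> la <= ln a -> 0 < b -> lb <= ln b ->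
  1 + lb < c -> 0 < 2 * c - a - b - (c - 1 - la) * u ->
  (c - 1 - lb) ^+ 2 * (4 - u ^+ 3) <
    3 * u * (2 * c - a - b - (c - 1 - la) * u) ^+ 2 ->
  rho u < s.
Proof.
move=> u01 s0 cs a0 aL b0 bL cb D0 H; apply: (rho_lt u01 s0 cs).
have v1 := f_other1_gt1 u01; have E := f_other1_eq u01; have /andP[u0 _] := u01.
rewrite /curve_mean /curve_xlnx; move: (f_other 1 u) v1 E => v v1 E.
have v0 : 0 < v by lra.
have := xlnx_ge_line u0 a0 aL; have := xlnx_ge_line v0 b0 bL.
suff : (c - 1 - lb) * v < 2 * c - a - b - (c - 1 - la) * u by lra.
have B0 : 0 < c - 1 - lb by lra.
rewrite -(@ltr_pXn2r _ 2) ?nnegrE ?(ltW D0) ?mulr_ge0 ?(ltW B0) ?(ltW v0) //.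
have u3 : 0 < 3 * u by lra.
rewrite -(ltr_pM2l u3); apply: le_lt_trans H.
by rewrite -E exprMn; lra.
Qed.

Lemma rho_far (R : realType) (u : R) : 5 / 100 <= u <= 34 / 100 -> rho u < 21 / 100.
Proof.
move=> /andP[u1 u2].
have L : 1 - 443 / 173 <= ln (21 / 100 : R).
  by apply: (@ln_ge_taylor _ 5); [lra|rewrite exp_taylor10E; lra].
have s0 : 0 < 21 / 100 :> R by lra.
have u01 : 0 < u < 1 by lra.
(* On [x, y] a cubic is bounded below by its values at the ends together with
   these products. *)
have cubic (x y : R) : x <= u <= y -> 0 <= (u - x) * (y - u) /\
    0 <= (u - x) * (y - u) * (u - x) /\ 0 <= (u - x) * (y - u) * (y - u).
  by move=> /andP[? ?]; rewrite !mulr_ge0 ?subr_ge0.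
have lnge (a t : R) : 0 < a -> 0 <= exp_taylor 10 (- t / 2) ->
  1 <= a * exp_taylor 10 (- t / 2) ^+ 2 -> t <= ln a := @ln_ge_taylor_sqr R a t.
have [v1|/ltW v1] := leP u (79 / 1000).
  have la : - 138 / 53 <= ln (74 / 1000 : R) by apply: lnge; rewrite ?exp_taylor10E; clear; lra.
  have lb : 327 / 226 <= ln (425 / 100 : R) by apply: lnge; rewrite ?exp_taylor10E; clear; lra.
  have [] := cubic (5 / 100) (79 / 1000) ltac:(lra); move=> H1 [H2 H3].
  by apply: (rho_lt_tangent u01 s0 L _ la _ lb); clear -u1 v1 H1 H2 H3; lra.
have [v2|/ltW v2] := leP u (100 / 1000).
  have la : - 106 / 43 <= ln (85 / 1000 : R) by apply: lnge; rewrite ?exp_taylor10E; clear; lra.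
  have lb : 139 / 101 <= ln (396 / 100 : R) by apply: lnge; rewrite ?exp_taylor10E; clear; lra.
  have [] := cubic (79 / 1000) (100 / 1000) ltac:(lra); move=> H1 [H2 H3].
  by apply: (rho_lt_tangent u01 s0 L _ la _ lb); clear -v1 v2 H1 H2 H3; lra.
have [v3|/ltW v3] := leP u (20 / 100).
  have la : - 109 / 51 <= ln (118 / 1000 : R) by apply: lnge; rewrite ?exp_taylor10E; clear; lra.
  have lb : 147 / 121 <= ln (337 / 100 : R) by apply: lnge; rewrite ?exp_taylor10E; clear; lra.
  have [] := cubic (100 / 1000) (20 / 100) ltac:(lra); move=> H1 [H2 H3].
  by apply: (rho_lt_tangent u01 s0 L _ la _ lb); clear -v2 v3 H1 H2 H3; lra.
have la : - 116 / 109 <= ln (345 / 1000 : R) by apply: lnge; rewrite ?exp_taylor10E; clear; lra.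
have lb : 72 / 107 <= ln (196 / 100 : R) by apply: lnge; rewrite ?exp_taylor10E; clear; lra.
have [] := cubic (20 / 100) (34 / 100) ltac:(lra); move=> H1 [H2 H3].
by apply: (rho_lt_tangent u01 s0 L _ la _ lb); clear -v3 u2 H1 H2 H3; lra.
Qed.

Lemma ln_le_tangent (R : realType) (a x : R) : 0 < a -> 0 < x ->
  ln x <= ln a + x / a - 1.
Proof.
move=> a0 x0; have xa0 : 0 < x / a by rewrite divr_gt0.
have -> : ln x = ln a + ln (x / a) by rewrite ln_div ?posrE //; ring.
rewrite -addrA lerD2l; have := @le_ln1Dx R (x / a - 1).
by rewrite [1 + _]addrC subrK; apply; rewrite ltrBrDr addNr.
Qed.

(** The point [u = 2/25] is close to the maximum of [rho]. *)
Lemma rho_ge_witness (R : realType) :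
  209 / 1000 <= rho (2 / 25 : R) /\ rho (2 / 25 : R) * f_other 1 (2 / 25 : R) <= 1.
Proof.
have [u uE] : exists u : R, u = 2 / 25 by exists (2 / 25).
rewrite -uE; have u01 : 0 < u < 1 by lra.
have := f_other1_eq u01; rewrite {1 2}uE => E; have v1 := f_other1_gt1 u01.
have vlo : 4082 / 1000 <= f_other 1 u.
  by rewrite -(@ler_pXn2r _ 2 isT) ?nnegrE; lra.
have vhi : f_other 1 u <= 4083 / 1000.
  by rewrite -(@ler_pXn2r _ 2 isT) ?nnegrE; lra.
split; last first.
  have r1 : rho u < 21 / 100 by apply: rho_far; lra.
  have := expR_ge0 (1 - curve_xlnx u / (curve_mean u - 1)).
  rewrite -/(rho _) => r0.
  have : rho u * f_other 1 u <= 21 / 100 * (4083 / 1000).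
    by apply: ler_pM; clear -r0 r1 v1 vhi; lra.
  by lra.
have s0 : 0 < 209 / 1000 :> R by lra.
rewrite -(lnK s0) /rho ler_expR.
have L : ln (209 / 1000 : R) <= 1 - 2565 / 1000.
  by apply: ln_le_taylor_sqr; rewrite ?exp_taylor10E; clear; lra.
apply: le_trans L _; rewrite lerD2l lerN2.
have := curve_mean_gt1 u01; rewrite -subr_gt0 => m0; rewrite ler_pdivrMr //.
have lu : ln u <= - 2525 / 1000.
  by rewrite uE; apply: ln_le_taylor_sqr; rewrite ?exp_taylor10E; clear; lra.
have lb : ln (4082 / 1000 : R) <= 211 / 150.
  by apply: ln_le_taylor_sqr; rewrite ?exp_taylor10E; clear; lra.
have lv : ln (f_other 1 u) <= 1407 / 1000.
  have c0 : 0 < 4082 / 1000 :> R by clear; lra.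
  have v0 : 0 < f_other 1 u by clear -v1; lra.
  have H : f_other 1 u / (4082 / 1000) <= 4083 / 4082 by clear -vhi; lra.
  have := ln_le_tangent c0 v0; clear -lb H; lra.
rewrite /curve_xlnx /curve_mean; move: (ln _) lu => lnu lu.
have ulnu : u * lnu = 2 / 25 * lnu by rewrite uE.
have : f_other 1 u * ln (f_other 1 u) <=
  4083 / 1000 * (1407 / 1000) by apply: ler_pM; rewrite ?ln_ge0 //; clear -v1 vhi lv; lra.
clear -vlo lu uE ulnu; lra.
Qed.

(** On this interval the cubic of [rho_lt_tangent] is convex, so it is compared
    with its tangent at the right end. *)
Lemma rho_left (R : realType) (u : R) : 5 / 100 <= u <= 6 / 100 -> rho u < 209 / 1000.
Proof.
move=> /andP[u1 u2]; have s0 : 0 < 209 / 1000 :> R by lra.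
have u01 : 0 < u < 1 by lra.
have L : 1 - 2566 / 1000 <= ln (209 / 1000 : R).
  by apply: ln_ge_taylor_sqr; rewrite ?exp_taylor10E; clear; lra.
have la : - 168 / 59 <= ln (58 / 1000 : R).
  by apply: ln_ge_taylor_sqr; rewrite ?exp_taylor10E; clear; lra.
have lb : 215 / 138 <= ln (475 / 100 : R).
  by apply: ln_ge_taylor_sqr; rewrite ?exp_taylor10E; clear; lra.
have H1 : 0 <= (6 / 100 - u) ^+ 2 by apply: sqr_ge0.
have H2 : 0 <= (6 / 100 - u) ^+ 2 * (u - 5 / 100).
  by rewrite mulr_ge0 ?sqr_ge0 // subr_ge0.
have H3 : 0 <= (6 / 100 - u) ^+ 3 by rewrite exprn_ge0 // subr_ge0.
by apply: (rho_lt_tangent u01 s0 L _ la _ lb); clear -u1 u2 H1 H2 H3; lra.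
Qed.

Lemma continuous_rho (R : realType) (u : R) : 0 < u < 1 -> {for u, continuous (@rho R)}.
Proof.
move=> /[dup] u01 /andP[u0 u1]; have v1 := f_other1_gt1 u01.
have cid : {for u, continuous (id : R -> R)} by exact: cvg_id.
have cv : {for u, continuous (@f_other R 1)}.
  apply: (@continuous_comp _ _ _ (fun u : R => (4 * 1 ^+ 3 - u ^+ 3) / (3 * u)) Num.sqrt).
    apply: cvgM; first by apply: cvgB; [exact: cvg_cst|exact: exprn_continuous].
    by apply: cvgV; [rewrite gt_eqF //; lra|apply: cvgM; [exact: cvg_cst|exact: cid]].
  exact: sqrt_continuous.
have clnv : {for u, continuous (fun u : R => ln (f_other 1 u))}.
  by apply: continuous_comp => //; apply: continuous_ln; lra.
have cm : {for u, continuous (@curve_mean R)}.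
  by apply: cvgM; [apply: cvgD; [exact: cid|exact: cv]|exact: cvg_cst].
have ck : {for u, continuous (@curve_xlnx R)}.
  apply: cvgM; last exact: cvg_cst.
  apply: cvgD; first by apply: cvgM; [exact: cid|exact: continuous_ln].
  by apply: cvgM; [exact: cv|exact: clnv].
apply: (@continuous_comp _ _ _ (fun u : R => 1 - curve_xlnx u / (curve_mean u - 1)) expR);
  last exact: continuous_expR.
apply: cvgB; first exact: cvg_cst.
apply: cvgM; first exact: ck.
apply: cvgV; first by rewrite subr_eq0 gt_eqF ?curve_mean_gt1.
by apply: cvgB; [exact: cm|exact: cvg_cst].
Qed.

(** Outside [6/100, 34/100] the values of [rho] are smaller than the one at
    [2/25], or the corresponding point violates [f_other r x <= 1]; inside,
    this constraint holds, so the maximum of the continuous [rho] is the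
    constant sought. *)
Lemma rlow_exists (R : realType) : exists rlow : R,
  [/\ f_has_zero rlow, forall r, f_has_zero r -> r <= rlow &
    209 / 1000 <= rlow < 210 / 1000].
Proof.
have cr (a b : R) : 0 < a -> b < 1 -> {within `[a, b], continuous (@rho R)}.
  move=> a0 b1; apply: continuous_in_subspaceT => x.
  rewrite inE /= in_itv /= => /andP[x1 x2]; apply: continuous_rho.
  by rewrite (lt_le_trans a0 x1) (le_lt_trans x2 b1).
have [|c|c cI cmax] := @EVT_max R (@rho R) (6 / 100) (34 / 100).
- by lra.
- by apply: cr; lra.
have [w1 w2] := rho_ge_witness R.
have {}cI : 6 / 100 <= c <= 34 / 100 by move: cI; rewrite in_itv.
have c1 : 209 / 1000 <= rho c.
  by apply: le_trans w1 _; apply: cmax; rewrite in_itv /=; apply/andP; split; lra.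
have c2 : rho c < 210 / 1000.
  by have := @rho_far R c ltac:(lra); lra.
have c01 : 0 < c < 1 by lra.
exists (rho c); split.
- apply/f_has_zeroE; first by lra.
  exists c => //; split => //.
  have v5 : f_other 1 c <= 4750 / 1000.
    rewrite -(@ler_pXn2r _ 2 isT) ?nnegrE; [|have := f_other1_gt1 c01; lra|lra].
    have E := f_other1_eq c01; have c3 : 0 <= c ^+ 3 by rewrite exprn_ge0; lra.
    have c0 : 0 < 3 * c by lra.
    by rewrite -(ler_pM2l c0); lra.
  have : rho c * f_other 1 c <= 210 / 1000 * (4750 / 1000).
    by apply: ler_pM; rewrite ?expR_ge0 ?(ltW c2) //; have := f_other1_gt1 c01; lra.
  by lra.
- move=> r /[dup] -[r01 _] /(f_has_zeroE r01)[u u01 [rE rv]].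
  have [u34|/ltW u34] := leP (34 / 100) u.
    rewrite rE; apply: le_trans c1; apply/ltW/rho_near.
    by move: u01 => /andP[_ ->]; rewrite u34.
  have [u6|/ltW u6] := leP (6 / 100) u.
    by rewrite rE; apply: cmax; rewrite in_itv /= u6 u34.
  apply: le_trans c1; have [u5|u5] := leP (5 / 100) u.
    by rewrite rE; apply/ltW/rho_left; rewrite u5 u6.
  have v5 : 5 <= f_other 1 u.
    rewrite -(@ler_pXn2r _ 2 isT) ?nnegrE; [|lra|have := f_other1_gt1 u01; lra].
    have E := f_other1_eq u01.
    have /andP[u0 u1] := u01.
    have u3 : u ^+ 3 <= u by rewrite -[leRHS]expr1 ler_wiXn2l // ltW.
    have c0 : 0 < 3 * u by lra.
    by rewrite -(ler_pM2l c0); lra.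
  have /andP[r0 _] := r01.
  have : r * 5 <= 1 by apply: le_trans rv; rewrite ler_pM2l.
  by lra.
- by rewrite c1 c2.
Qed.

(** * Integration over the square and the cube *)

(** Tonelli's theorem on a rectangle, by extending the integrand by [0]. *)
Section FubiniOn.
Local Open Scope ereal_scope.
Context d1 d2 (T1 : measurableType d1) (T2 : measurableType d2) (R : realType).
Variables (m1 : {sigma_finite_measure set T1 -> \bar R})
  (m2 : {sigma_finite_measure set T2 -> \bar R}).
Variables (D1 : set T1) (D2 : set T2) (g : T1 * T2 -> \bar R).
Hypotheses (mD1 : measurable D1) (mD2 : measurable D2).
Hypothesis mg : measurable_fun (D1 `*` D2) g.
Hypothesis g0 : forall z, (D1 `*` D2) z -> 0 <= g z.

Let mD : measurable (D1 `*` D2) := measurableX mD1 mD2.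
Let gT := g \_ (D1 `*` D2).
Let mgT : measurable_fun setT gT.
Proof. exact/(measurable_restrictT _ mD). Qed.

Let gT0 z : 0 <= gT z.
Proof. by rewrite /gT patchE; case: ifPn => // /set_mem /g0. Qed.

Let inner x : \int[m2]_y gT (x, y) = ((fun x => \int[m2]_(y in D2) g (x, y)) \_ D1) x.
Proof.
rewrite patchE; case: ifPn => [/set_mem x1|/negP x1].
  rewrite [RHS]integral_mkcond; apply: eq_integral => y _; rewrite /gT !patchE.
  by congr (if _ then _ else _); apply/idP/idP => /set_mem H; apply/mem_set; [case: H|split].
rewrite (eq_integral (cst 0)) ?integral0 // => y _; rewrite /gT patchE.
by case: ifPn => // /set_mem [/= xD _]; case: x1; apply/mem_set.
Qed.

Lemma fubini_tonelli_on : \int[(m1 \x m2)%E]_(z in D1 `*` D2) g z =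
  \int[m1]_(x in D1) \int[m2]_(y in D2) g (x, y).
Proof.
rewrite integral_mkcond [RHS]integral_mkcond (@fubini_tonelli1 _ _ T1 T2 R m1 m2 gT mgT gT0).
by apply: eq_integral => x _; rewrite -inner.
Qed.

Lemma measurable_fubini_tonelli_on :
  measurable_fun D1 (fun x => \int[m2]_(y in D2) g (x, y)).
Proof.
apply/(measurable_restrictT _ mD1).
have := @measurable_fun_fubini_tonelli_F _ _ T1 T2 R m2 gT mgT gT0.
by apply: eq_measurable_fun => x _; rewrite -inner.
Qed.

End FubiniOn.

Lemma product_sigma_finite d1 d2 (T1 : measurableType d1) (T2 : measurableType d2)
  (R : realType) (m1 : {sigma_finite_measure set T1 -> \bar R})
  (m2 : {sigma_finite_measure set T2 -> \bar R}) :
  sigma_finite setT (m1 \x m2)%E.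
Proof.
have [F FT Foo] := sigma_finiteT m1; have [G GT Goo] := sigma_finiteT m2.
exists (fun n => if unpickle n is Some (i, j) then F i `*` G j else set0).
  apply/seteqP; split=> // -[x y] _.
  have [i _ Fx] : (\bigcup_i F i) x by rewrite -FT.
  have [j _ Gy] : (\bigcup_i G i) y by rewrite -GT.
  by exists (pickle (i, j)) => //; rewrite pickleK.
move=> n; case: (unpickle n) => [[i j]|]; last by rewrite measure0; split.
have [mF Fi] := Foo i; have [mG Gj] := Goo j.
split; first exact: measurableX.
by rewrite product_measure1E // lte_mul_pinfty // ge0_fin_numE.
Qed.

(** A name for the product, on which its sigma-finiteness can be registered, as
    Tonelli's theorem on the cube requires. *)
Definition plane_measure (R : realType) :=
  (@lebesgue_measure R \x @lebesgue_measure R)%E.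

HB.instance Definition _ (R : realType) := Measure.on (@plane_measure R).
HB.instance Definition _ (R : realType) := Measure_isSigmaFinite.Build _ _ _
  (@plane_measure R) (@product_sigma_finite _ _ _ _ R _ _).

Lemma integral_cst_mass1 d (T : measurableType d) (R : realType)
  (m : {measure set T -> \bar R}) (D : set T) (c : \bar R) :
  measurable D -> m D = 1%E -> (\int[m]_(x in D) c)%E = c.
Proof. by move=> mD D1; rewrite integral_cst // D1 mule1. Qed.

Section Square.
Local Open Scope ereal_scope.
Context (R : realType).
Let T := measurableTypeR R.
Let mu := @lebesgue_measure R.
Let plane := @plane_measure R.
Let I : set T := @unitI R.

Lemma measurable_unitI : measurable I.
Proof. exact: measurable_itv. Qed.

Lemma lebesgue_measure_unitI : mu I = 1.
Proof.
by rewrite [LHS]lebesgue_measure_itv /= lte_fin ltr01 -EFinB subr0.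
Qed.

Lemma measurable_unitI2 : measurable (I `*` I).
Proof. by apply: measurableX; exact: measurable_unitI. Qed.

Lemma measurable_unitI3 : measurable ((I `*` I) `*` I).
Proof. by apply: measurableX; [exact: measurable_unitI2|exact: measurable_unitI]. Qed.

Variable g : T * T -> \bar R.
Hypothesis mg : measurable_fun (I `*` I) g.
Hypothesis g0 : forall z, (I `*` I) z -> 0 <= g z.

(** The three coordinate projections of the cube onto the square preserve the
    integral: one of the three iterated integrals has a constant integrand. *)
Lemma integral_cube12 : \int[plane \x mu]_(z in (I `*` I) `*` I) g z.1 =
  \int[plane]_(z in I `*` I) g z.
Proof.
rewrite (@fubini_tonelli_on _ _ _ _ R plane mu (I `*` I) I (fun z => g z.1)).
- by apply: eq_integral => z _; rewrite /=; apply: integral_cst_mass1; [exact: measurable_unitI|exact: lebesgue_measure_unitI].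
- exact: measurable_unitI2.
- exact: measurable_unitI.
- apply: (measurable_comp measurable_unitI2 _ mg).
    by move=> _ [z [z1 _] <-].
  by apply: measurable_funTS; exact: measurable_fst.
- by move=> z [/g0].
Qed.

Let mG : measurable_fun I (fun x => \int[mu]_(y in I) g (x, y)).
Proof. exact: (measurable_fubini_tonelli_on mu measurable_unitI measurable_unitI mg g0). Qed.

Let G0 x : I x -> 0 <= \int[mu]_(y in I) g (x, y).
Proof. by move=> Ix; apply: integral_ge0 => y Iy; apply: g0. Qed.

Lemma integral_cube13 : \int[plane \x mu]_(z in (I `*` I) `*` I) g (z.1.1, z.2) =
  \int[plane]_(z in I `*` I) g z.
Proof.
rewrite (@fubini_tonelli_on _ _ _ _ R plane mu (I `*` I) I (fun z => g (z.1.1, z.2))).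
- rewrite (@fubini_tonelli_on _ _ _ _ R mu mu I I
    (fun z => \int[mu]_(y in I) g (z.1, y))).
  + rewrite (@fubini_tonelli_on _ _ _ _ R mu mu I I g) //; try exact: measurable_unitI.
    by apply: eq_integral => x _; rewrite /=; apply: integral_cst_mass1; [exact: measurable_unitI|exact: lebesgue_measure_unitI].
  + exact: measurable_unitI.
  + exact: measurable_unitI.
  + apply: (measurable_comp measurable_unitI _ mG).
      by move=> _ [z [z1 _] <-].
    by apply: measurable_funTS; exact: measurable_fst.
  + by move=> z [/G0].
- exact: measurable_unitI2.
- exact: measurable_unitI.
- apply: (measurable_comp measurable_unitI2 _ mg).
    by move=> _ [z [[z1 _] z2] <-].
  apply: measurable_funTS; apply: measurable_fun_pair; last exact: measurable_snd.
  by apply: measurableT_comp; exact: measurable_fst.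
- by move=> z [[z1 _] z2]; apply: g0.
Qed.

Lemma integral_cube23 : \int[plane \x mu]_(z in (I `*` I) `*` I) g (z.1.2, z.2) =
  \int[plane]_(z in I `*` I) g z.
Proof.
rewrite (@fubini_tonelli_on _ _ _ _ R plane mu (I `*` I) I (fun z => g (z.1.2, z.2))).
- rewrite (@fubini_tonelli_on _ _ _ _ R mu mu I I
    (fun z => \int[mu]_(y in I) g (z.2, y))).
  + rewrite (@fubini_tonelli_on _ _ _ _ R mu mu I I g) //; try exact: measurable_unitI.
    rewrite /=; apply: integral_cst_mass1; [exact: measurable_unitI|exact: lebesgue_measure_unitI].
  + exact: measurable_unitI.
  + exact: measurable_unitI.
  + apply: (measurable_comp measurable_unitI _ mG).
      by move=> _ [z [_ z2] <-].
    by apply: measurable_funTS; exact: measurable_snd.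
  + by move=> z [_ /G0].
- exact: measurable_unitI2.
- exact: measurable_unitI.
- apply: (measurable_comp measurable_unitI2 _ mg).
    by move=> _ [z [[_ z1] z2] <-].
  apply: measurable_funTS; apply: measurable_fun_pair; last exact: measurable_snd.
  by apply: measurableT_comp; [exact: measurable_snd|exact: measurable_fst].
- by move=> z [[_ z1] z2]; apply: g0.
Qed.

End Square.

(** * The constant graphon is optimal when [q / p] is large *)

(** The shape of [rel_entropy_triple]: three terms on each side for the edges of
    a triangle, and [s] for the product of their weights. *)
Lemma integral_le_combination d (T : measurableType d) (R : realType)
    (m : {measure set T -> \bar R}) (D : set T) (a1 a2 a3 b1 b2 b3 s : T -> R)
    (c k l : R) :
  measurable D -> m D = 1%E -> 0 <= c -> 0 <= k -> 0 <= l ->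
  [/\ measurable_fun D a1, measurable_fun D a2 & measurable_fun D a3] ->
  [/\ measurable_fun D b1, measurable_fun D b2, measurable_fun D b3 &
    measurable_fun D s] ->
  (forall z, D z -> [/\ 0 <= a1 z, 0 <= a2 z & 0 <= a3 z]) ->
  (forall z, D z -> [/\ 0 <= b1 z, 0 <= b2 z, 0 <= b3 z & 0 <= s z]) ->
  (forall z, D z -> c + k * (a1 z + a2 z + a3 z) <= b1 z + b2 z + b3 z + l * s z) ->
  (c%:E + k%:E * (\int[m]_(z in D) (a1 z)%:E + \int[m]_(z in D) (a2 z)%:E
     + \int[m]_(z in D) (a3 z)%:E) <=
  \int[m]_(z in D) (b1 z)%:E + \int[m]_(z in D) (b2 z)%:E
     + \int[m]_(z in D) (b3 z)%:E + l%:E * \int[m]_(z in D) (s z)%:E)%E.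
Proof.
move=> mD D1 c0 k0 l0 [ma1 ma2 ma3] [mb1 mb2 mb3 ms] a0 b0 H.
have mE g : measurable_fun D g -> measurable_fun D (fun z => (g z)%:E) by move=> ?; exact/measurable_EFinP.
have I2 (g1 g2 : T -> R) : measurable_fun D g1 -> measurable_fun D g2 ->
    (forall z, D z -> 0 <= g1 z) -> (forall z, D z -> 0 <= g2 z) ->
    (\int[m]_(z in D) (g1 z)%:E + \int[m]_(z in D) (g2 z)%:E =
     \int[m]_(z in D) (g1 z + g2 z)%:E)%E.
  move=> mg1 mg2 g10 g20; rewrite -ge0_integralD //; exact: mE.
have IZ (r : R) (g : T -> R) : 0 <= r -> measurable_fun D g ->
    (forall z, D z -> 0 <= g z) ->
    (r%:E * \int[m]_(z in D) (g z)%:E = \int[m]_(z in D) (r * g z)%:E)%E.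
  by move=> r0 mg g0; rewrite -ge0_integralZl_EFin //; exact: mE.
have a10 z : D z -> 0 <= a1 z by move/a0 => [].
have a20 z : D z -> 0 <= a2 z by move/a0 => [].
have a30 z : D z -> 0 <= a3 z by move/a0 => [].
have b10 z : D z -> 0 <= b1 z by move/b0 => [].
have b20 z : D z -> 0 <= b2 z by move/b0 => [].
have b30 z : D z -> 0 <= b3 z by move/b0 => [].
have s0 z : D z -> 0 <= s z by move/b0 => [].
have ma12 := measurable_funD ma1 ma2; have ma123 := measurable_funD ma12 ma3.
have mb12 := measurable_funD mb1 mb2; have mb123 := measurable_funD mb12 mb3.
have a120 z : D z -> 0 <= a1 z + a2 z by move=> Dz; rewrite addr_ge0 ?a10 ?a20.
have a1230 z : D z -> 0 <= a1 z + a2 z + a3 z.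
  by move=> Dz; rewrite addr_ge0 ?a120 ?a30.
have b120 z : D z -> 0 <= b1 z + b2 z by move=> Dz; rewrite addr_ge0 ?b10 ?b20.
have b1230 z : D z -> 0 <= b1 z + b2 z + b3 z.
  by move=> Dz; rewrite addr_ge0 ?b120 ?b30.
have mZ (r : R) (g : T -> R) : measurable_fun D g -> measurable_fun D (fun z => r * g z).
  by move=> mg; apply: measurable_funM => //; exact: measurable_cst.
have ka0 z : D z -> 0 <= k * (a1 z + a2 z + a3 z).
  by move=> Dz; rewrite mulr_ge0 ?a1230.
have ls0 z : D z -> 0 <= l * s z by move=> Dz; rewrite mulr_ge0 ?s0.
have mc : measurable_fun D (fun=> c) by exact: measurable_cst.
have Dc : (c%:E = \int[m]_(z in D) c%:E)%E by rewrite integral_cst_mass1.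
rewrite [X in (X + _ <= _)%E]Dc (I2 _ _ ma1 ma2 a10 a20) (I2 _ _ ma12 ma3 a120 a30).
rewrite (IZ _ _ k0 ma123 a1230) (I2 _ _ mc (mZ k _ ma123) (fun z _ => c0) ka0).
rewrite (I2 _ _ mb1 mb2 b10 b20) (I2 _ _ mb12 mb3 b120 b30) (IZ _ _ l0 ms s0).
rewrite (I2 _ _ mb123 (mZ l _ ms) b1230 ls0).
apply: ge0_le_integral => //.
- by move=> z Dz; rewrite lee_fin addr_ge0 // ka0.
- by apply: mE; apply: measurable_funD => //; exact: mZ.
- by apply: mE; apply: measurable_funD => //; exact: mZ.
Qed.

Lemma measurable_rel_entropy (R : realType) (p : R) :
  measurable_fun setT (rel_entropy p).
Proof.
have ml (g : R -> R) : measurable_fun setT g -> measurable_fun setT (fun x => ln (g x)).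
  by move=> mg; exact: measurableT_comp (@measurable_ln R) mg.
have m1 : measurable_fun setT (fun x : R => 1 - x).
  by apply: measurable_funB => //; exact: measurable_cst.
apply: measurable_funD; apply: measurable_funM => //; apply: ml.
- by apply: measurable_funM => //; exact: measurable_cst.
- by apply: measurable_funM => //; exact: measurable_cst.
Qed.

Lemma measurable_h (R : realType) : measurable_fun setT (@h R).
Proof.
apply: measurable_funD; last exact: measurable_cst.
apply: measurable_funB => //; apply: measurable_funM => //.
Qed.

Lemma measurable_h_min (R : realType) (p q : R) :
  measurable_fun setT (fun a : R => h (Num.min a p / q)).
Proof.
apply: (measurableT_comp (@measurable_h R)).
apply: measurable_funM; last exact: measurable_cst.
by apply: measurable_minr => //; exact: measurable_cst.
Qed.

Lemma measurable_graphon_comp (R : realType) (W : R -> R -> R) (g : R -> R) :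
  graphon W -> measurable_fun setT g ->
  measurable_fun ((unitI `*` unitI) : set (measurableTypeR R * measurableTypeR R))
    (fun z => g (W z.1 z.2)).
Proof. by move=> [mW _ _] mg; exact: measurableT_comp mg mW. Qed.

Lemma square_mass1 (R : realType) : @plane_measure R (unitI `*` unitI) = 1%E.
Proof.
transitivity (@lebesgue_measure R unitI * @lebesgue_measure R unitI)%E.
  by apply: product_measure1E; exact: measurable_unitI.
by rewrite lebesgue_measure_unitI mule1.
Qed.

Lemma cube_mass1 (R : realType) :
  (@plane_measure R \x @lebesgue_measure R)%E ((unitI `*` unitI) `*` unitI) = 1%E.
Proof.
transitivity (@plane_measure R (unitI `*` unitI) * @lebesgue_measure R unitI)%E.
  by apply: product_measure1E; [exact: measurable_unitI2|exact: measurable_unitI].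
by rewrite square_mass1 lebesgue_measure_unitI mule1.
Qed.

Lemma ereal_combination_bound (R : realType) (c k l s : R) (A B S : \bar R) :
  0 < k -> 0 <= l ->
  ((3 * c + l * s)%:E + k%:E * (A + A + A) <= B + B + B + l%:E * S)%E ->
  (0 <= S <= s%:E)%E -> (0 <= A)%E -> (0 <= B)%E -> (c%:E + k%:E * A <= B)%E.
Proof.
move=> k0 l0 + /andP[]; case: S => [S| |] //; case: B => [B| |] //; last first.
  by move=> *; rewrite leey.
case: A => [A| |] //.
- rewrite -!EFinD !lee_fin => H S0 Ss A0 B0.
  have : l * S <= l * s by rewrite ler_wpM2l.
  by lra.
- by rewrite (_ : +oo + +oo + +oo = +oo)%E // gt0_muley ?lte_fin // -!EFinD addey.
Qed.

(** Each edge of the triangle contributes the same expectation to the integral of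
    [rel_entropy_triple] over the cube, and the bound on the triangle density
    cancels the cubic terms. *)
Lemma rel_entropy_gap (R : realType) (p q : R) (W : R -> R -> R) :
  0 < p < 1 -> q < p -> 466 / 1000 * p < q -> tilt p q <= 769 / 1000 ->
  LT_feasible q W ->
  ((rel_entropy p q)%:E
     + (q / 770)%:E * graphon_expect (fun a => h (Num.min a p / q)) W
   <= graphon_expect (rel_entropy p) W)%E.
Proof.
move=> p01 qp pq t1 [gW tW]; have /andP[p0 p1] := p01.
have q0 : 0 < q by lra.
have t0 := tilt_ge0 p01 q0 (ltW qp).
have [mW W01 _] := gW.
pose T := measurableTypeR R.
pose D : set (T * T * T) := (unitI `*` unitI) `*` unitI.
pose m := (@plane_measure R \x @lebesgue_measure R)%E.
have mI : measurable (unitI : set T) := @measurable_unitI R.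
have mD : measurable D := @measurable_unitI3 R.
have mD1 : m D = 1%E := @cube_mass1 R.
pose hq a := h (Num.min a p / q).
have m12 : measurable_fun D (fun z : T * T * T => z.1).
  by apply: measurable_funTS; exact: measurable_fst.
have m13 : measurable_fun D (fun z : T * T * T => (z.1.1, z.2)).
  apply: measurable_funTS; apply: measurable_fun_pair; last exact: measurable_snd.
  by apply: measurableT_comp; exact: measurable_fst.
have m23 : measurable_fun D (fun z : T * T * T => (z.1.2, z.2)).
  apply: measurable_funTS; apply: measurable_fun_pair; last exact: measurable_snd.
  by apply: measurableT_comp; [exact: measurable_snd|exact: measurable_fst].
have cm (g : R -> R) (k : T * T * T -> T * T) : measurable_fun setT g ->
    measurable_fun D k -> (forall z, D z -> (unitI `*` unitI) (k z)) ->
    measurable_fun D (fun z => g (W (k z).1 (k z).2)).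
  move=> mg mk kD.
  apply: (measurable_comp (@measurable_unitI2 R) _ (measurable_graphon_comp gW mg) mk).
  by move=> _ [z Dz <-]; exact: kD.
have D12 z : D z -> (unitI `*` unitI) z.1 by case.
have D13 z : D z -> (unitI `*` unitI) (z.1.1, z.2) by case=> -[].
have D23 z : D z -> (unitI `*` unitI) (z.1.2, z.2) by case=> -[].
have hq0 x y : unitI x -> unitI y -> 0 <= hq (W x y).
  move=> Ix Iy; have /andP[w0 _] := W01 _ _ Ix Iy.
  by rewrite h_ge0 // divr_ge0 ?(ltW q0) // le_min w0 ltW.
have I0 x y : unitI x -> unitI y -> 0 <= rel_entropy p (W x y).
  by move=> Ix Iy; rewrite rel_entropy_ge0 // W01.
have mh := measurable_h_min p q; have mr := measurable_rel_entropy p.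
have mid : measurable_fun setT (id : R -> R) by exact: measurable_id.
pose tri (z : T * T * T) := W z.1.1 z.1.2 * W z.1.1 z.2 * W z.1.2 z.2.
have mtri : measurable_fun D tri.
  apply: measurable_funM; first apply: measurable_funM.
  - exact: (cm id _ mid m12 D12).
  - exact: (cm id _ mid m13 D13).
  - exact: (cm id _ mid m23 D23).
have cube (g : R -> R) : measurable_fun setT g ->
    (forall x y, unitI x -> unitI y -> 0 <= g (W x y)) ->
    [/\ (\int[m]_(z in D) (g (W z.1.1 z.1.2))%:E = graphon_expect g W)%E,
      (\int[m]_(z in D) (g (W z.1.1 z.2))%:E = graphon_expect g W)%E &
      (\int[m]_(z in D) (g (W z.1.2 z.2))%:E = graphon_expect g W)%E].
  move=> mg g0; pose G (z : T * T) := (g (W z.1 z.2))%:E.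
  have mG : measurable_fun ((unitI `*` unitI) : set (T * T)) G.
    by apply/measurable_EFinP; exact: (measurable_graphon_comp gW mg).
  have G0 z : (unitI `*` unitI) z -> (0 <= G z)%E.
    by move=> [z1 z2]; rewrite lee_fin; exact: g0.
  by split; [exact: (integral_cube12 mG G0)|exact: (integral_cube13 mG G0)
    |exact: (integral_cube23 mG G0)].
have [h1 h2 h3] := cube _ mh hq0; have [r1 r2 r3] := cube _ mr I0.
have := @integral_le_combination _ _ _ m D
  (fun z => hq (W z.1.1 z.1.2)) (fun z => hq (W z.1.1 z.2)) (fun z => hq (W z.1.2 z.2))
  (fun z => rel_entropy p (W z.1.1 z.1.2)) (fun z => rel_entropy p (W z.1.1 z.2))
  (fun z => rel_entropy p (W z.1.2 z.2)) tri
  (3 * rel_entropy p q + tilt p q * q) (q / 770) (tilt p q / q ^+ 2) mD mD1.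
rewrite h1 h2 h3 r1 r2 r3 => main.
have t2 : 0 <= tilt p q / q ^+ 2 by rewrite divr_ge0 // sqr_ge0.
have q01 : 0 <= q <= 1 by rewrite (ltW q0) ltW // (lt_trans qp).
have P0 := addr_ge0 (mulr_ge0 (ler0n R 3) (rel_entropy_ge0 p01 q01))
  (mulr_ge0 t0 (ltW q0)).
have k0 : 0 < q / 770 by rewrite (pmulr_rgt0 _ q0) invr_gt0 ltr0n.
have P1 := ltW k0.
have P2 : forall z, D z ->
    [/\ 0 <= hq (W z.1.1 z.1.2), 0 <= hq (W z.1.1 z.2) & 0 <= hq (W z.1.2 z.2)].
  by move=> z [[z1 z2] z3]; split; exact: hq0.
have P3 : forall z, D z -> [/\ 0 <= rel_entropy p (W z.1.1 z.1.2),
    0 <= rel_entropy p (W z.1.1 z.2), 0 <= rel_entropy p (W z.1.2 z.2) & 0 <= tri z].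
  move=> z [[z1 z2] z3]; split; try exact: I0.
  have /andP[? _] := W01 _ _ z1 z2; have /andP[? _] := W01 _ _ z1 z3.
  by have /andP[? _] := W01 _ _ z2 z3; rewrite !mulr_ge0.
have {}main := main P0 P1 t2
  (And3 (cm _ _ mh m12 D12) (cm _ _ mh m13 D13) (cm _ _ mh m23 D23))
  (And4 (cm _ _ mr m12 D12) (cm _ _ mr m13 D13) (cm _ _ mr m23 D23) mtri) P2 P3.
have {}main := main (fun z Dz => rel_entropy_triple p01 qp pq t1
  (W01 _ _ Dz.1.1 Dz.1.2) (W01 _ _ Dz.1.1 Dz.2) (W01 _ _ Dz.1.2 Dz.2)).
have tE : (\int[m]_(z in D) (tri z)%:E = triangle_density W)%E by [].
rewrite tE in main.
have hE0 : (0 <= graphon_expect (fun a => hq a) W)%E.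
  by apply: integral_ge0 => z [z1 z2]; rewrite lee_fin; exact: hq0.
have tD0 : (0 <= triangle_density W)%E.
  by rewrite -tE; apply: integral_ge0 => z /P3[]; rewrite lee_fin.
have rE0 : (0 <= graphon_expect (rel_entropy p) W)%E.
  by apply: integral_ge0 => z [z1 z2]; rewrite lee_fin; exact: I0.
have q2 : tilt p q * q = tilt p q / q ^+ 2 * q ^+ 3 by field; rewrite gt_eqF.
rewrite q2 in main.
have S0 : (0 <= triangle_density W <= (q ^+ 3)%:E)%E by rewrite tD0 tW.
exact: (ereal_combination_bound k0 t2 main S0 hE0 rE0).
Qed.

Lemma graphon_const (R : realType) (q : R) : 0 <= q <= 1 -> graphon (const_graphon q).
Proof. by move=> q01; split => //; exact: measurable_cst. Qed.

Lemma graphon_expect_const (R : realType) (g : R -> R) (q : R) :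
  graphon_expect g (const_graphon q) = (g q)%:E.
Proof.
rewrite /graphon_expect /const_graphon.
exact: (integral_cst_mass1 _ (@measurable_unitI2 R) (@square_mass1 R)).
Qed.

Lemma triangle_density_const (R : realType) (q : R) :
  triangle_density (const_graphon q) = (q ^+ 3)%:E.
Proof.
rewrite (_ : q ^+ 3 = q * q * q); last by rewrite !exprS expr0 mulr1 mulrA.
rewrite /triangle_density /const_graphon.
exact: (integral_cst_mass1 _ (@measurable_unitI3 R) (@cube_mass1 R)).
Qed.

(** Another minimizer [W] makes the gap of [rel_entropy_gap] vanish, hence
    [min W p = q] almost everywhere, and [q < p]. *)
Lemma const_unique_minimizer (R : realType) (p q : R) :
  0 < p <= 1 / 250 -> q < p -> 466 / 1000 * p < q ->
  LT_unique_minimizer p q (const_graphon q).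
Proof.
move=> p250 qp pq; have t1 := tilt_le p250 qp pq.
have p01 : 0 < p < 1 by lra.
have [p0 p1] := andP p01; have q0 : 0 < q by clear -p0 pq; lra.
have q01 : 0 <= q <= 1 by rewrite (ltW q0) ltW // (lt_trans qp).
have k0 : 0 < q / 770 by rewrite (pmulr_rgt0 _ q0) invr_gt0 ltr0n.
pose hq (a : R) := h (Num.min a p / q).
have hq0 (W : R -> R -> R) z : graphon W -> (unitI `*` unitI) z -> 0 <= hq (W z.1 z.2).
  move=> [_ W01 _] [z1 z2]; have /andP[w0 _] := W01 _ _ z1 z2.
  by rewrite h_ge0 // divr_ge0 ?(ltW q0) // le_min w0 ltW.
have EH0 (W : R -> R -> R) : graphon W -> (0 <= graphon_expect hq W)%E.
  by move=> gW; apply: integral_ge0 => z Dz; rewrite lee_fin; exact: hq0.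
have gc := graphon_const q01.
split.
  split; first by split => //; rewrite triangle_density_const.
  move=> W fW; rewrite graphon_expect_const.
  apply: le_trans (rel_entropy_gap p01 qp pq t1 fW).
  apply: leeDl; apply: mule_ge0; last exact: EH0 fW.1.
  by rewrite lee_fin; exact: ltW k0.
move=> W [fW minW]; have gW := fW.1.
have H : (graphon_expect hq W = 0)%E.
  apply/eqP; rewrite eq_le EH0 // andbT.
  have fc : LT_feasible q (const_graphon q) by split => //; rewrite triangle_density_const.
  have := le_trans (rel_entropy_gap p01 qp pq t1 fW) (minW _ fc).
  rewrite graphon_expect_const -/hq; have := EH0 W gW.
  case: (graphon_expect hq W) => [e| |] //.
    rewrite -!EFinD !lee_fin => _ H.
    have {}H : q / 770 * e <= 0 by lra.
    by rewrite -(pmulr_rle0 _ k0).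
  by rewrite gt0_muley ?lte_fin // addey.
apply: Relation_Operators.rst_step; split => //; left.
pose T := measurableTypeR R.
have mH : measurable_fun ((unitI `*` unitI) : set (T * T)) (fun z => (hq (W z.1 z.2))%:E).
  by apply/measurable_EFinP; exact: (measurable_graphon_comp gW (measurable_h_min p q)).
have [+ _] := ae_eq_integral_abs (@plane_measure R) (@measurable_unitI2 R) mH.
have absE : (\int[@plane_measure R]_(z in unitI `*` unitI) `|(hq (W z.1 z.2))%:E| =
    graphon_expect hq W)%E.
  apply: eq_integral => z /set_mem Dz; rewrite gee0_abs // lee_fin; exact: hq0.
rewrite absE => /(_ H); apply: filterS => z Hz Dz.
have := Hz Dz; move=> /= -[] E.
have [_ W01 _] := gW; have /andP[w0 _] := W01 _ _ Dz.1 Dz.2.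
have m0 : 0 <= Num.min (W z.1 z.2) p / q.
  by rewrite divr_ge0 ?(ltW q0) // le_min w0 ltW.
have /divr1_eq mq := h_eq0 m0 E.
have : Num.min (W z.1 z.2) p = q by exact: mq.
rewrite /const_graphon; have [//|_ pq'] := leP (W z.1 z.2) p.
by rewrite pq' ltxx in qp.
Qed.

(** * Two-block graphons *)

Definition two_block (R : realType) (x y : R) : R -> R -> R :=
  fun s t => if (s < 1 / 2) == (t < 1 / 2) then x else y.

Section HalfIntegrals.
Context (R : realType).
Let T := measurableTypeR R.
Let mu := @lebesgue_measure R.
Let I : set T := @unitI R.

Let lower (s : T) : bool := (s : R) < 1 / 2.

Let measurable_lower : measurable_fun setT lower.
Proof. by apply: measurable_fun_ltr => //; exact: measurable_cst. Qed.

Let measurable_bool d (S : measurableType d) (b : S -> bool) (F : bool -> S -> R) :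
  measurable_fun setT b -> (forall c, measurable_fun setT (F c)) ->
  measurable_fun setT (fun z => F (b z) z).
Proof.
move=> mb mF; rewrite (_ : (fun z => F (b z) z) =
  (fun z => if b z then F true z else F false z)).
  by apply: measurable_fun_ifT.
by apply/funext => z; case: (b z).
Qed.

Lemma integral_half (g : bool -> R) : (forall b, 0 <= g b) ->
  (\int[mu]_(s in I) (g (lower s))%:E)%E = ((g true + g false) / 2)%:E.
Proof.
move=> g0.
pose A : set T := [set` `[0, 1 / 2[%R]; pose B : set T := [set` `[1 / 2, 1]%R].
have mA : measurable A by exact: measurable_itv.
have mB : measurable B by exact: measurable_itv.
have IE : I = A `|` B.
  apply/seteqP; split => s; rewrite /I /A /B /unitI /= !in_itv /=.
    by move=> /andP[s0 s1]; have [?|?] := ltP (s : R) (1 / 2);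
      [left; rewrite s0|right; rewrite s1 andbT].
  by case => /andP[s0 s1]; apply/andP; split; lra.
have muA : mu A = (1 / 2)%:E.
  by rewrite /mu /A lebesgue_measure_itv /= lte_fin divr_gt0 // -EFinB subr0.
have muB : mu B = (1 / 2)%:E.
  have half1 : 1 / 2 < 1 :> R by lra.
  rewrite /mu /B lebesgue_measure_itv /= lte_fin half1.
  by rewrite -EFinB; congr EFin; field.
have mg : measurable_fun setT (fun s : T => (g (lower s))%:E).
  apply/measurable_EFinP.
  apply: (measurable_bool (F := fun b _ => g b) measurable_lower) => b.
  exact: measurable_cst.
rewrite IE ge0_integral_setU //; last 3 first.
- exact: measurable_funTS.
- by move=> s _; rewrite lee_fin.
- apply/disj_setPS => s; rewrite /A /B /= => -[]; rewrite !in_itv /= => /andP[_ s1] /andP[s2 _].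
  by move: s1; rewrite ltNge s2.
rewrite (eq_integral (cst (g true)%:E)); last first.
  by move=> s; rewrite inE /A /B /= in_itv /= /lower => /andP[_ ->].
rewrite [X in (_ + X)%E](eq_integral (cst (g false)%:E)); last first.
  by move=> s; rewrite inE /A /B /= in_itv /= /lower => /andP[s2 _]; rewrite ltNge s2.
rewrite !integral_cst // [X in (_ * X + _)%E]muA [X in (_ + _ * X)%E]muB.
by rewrite -!EFinM -EFinD; congr EFin; field.
Qed.

Lemma integral_half2 (g : bool -> bool -> R) : (forall b c, 0 <= g b c) ->
  (\int[@plane_measure R]_(z in I `*` I) (g (lower z.1) (lower z.2))%:E)%E =
  ((g true true + g true false + g false true + g false false) / 4)%:E.
Proof.
move=> g0; pose G (z : T * T) := (g (lower z.1) (lower z.2))%:E.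
have mG : measurable_fun (I `*` I) G.
  apply: measurable_funTS; apply/measurable_EFinP.
  apply: (measurable_bool (b := fun z : T * T => lower z.1)
    (F := fun b (z : T * T) => g b (lower z.2))).
    by apply: measurableT_comp => //; exact: measurable_fst.
  move=> b; apply: (measurable_bool (b := fun z : T * T => lower z.2)
    (F := fun c (z : T * T) => g b c)); last by move=> c; exact: measurable_cst.
  by apply: measurableT_comp => //; exact: measurable_snd.
have G0 z : (I `*` I) z -> (0 <= G z)%E by move=> _; rewrite lee_fin.
rewrite -/G.
transitivity (\int[mu]_(s in I) (\int[mu]_(t in I) G (s, t)))%E.
  exact: (fubini_tonelli_on mu mu (@measurable_unitI R) (@measurable_unitI R) mG G0).
rewrite (eq_integral (fun s => ((g (lower s) true + g (lower s) false) / 2)%:E)).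
  rewrite (integral_half (g := fun b => (g b true + g b false) / 2)).
    by congr EFin; field.
  by move=> b; rewrite divr_ge0 // addr_ge0.
by move=> s _; rewrite -integral_half.
Qed.

Lemma integral_half3 (g : bool -> bool -> bool -> R) : (forall b c d, 0 <= g b c d) ->
  (\int[@plane_measure R \x mu]_(z in (I `*` I) `*` I)
     (g (lower z.1.1) (lower z.1.2) (lower z.2))%:E)%E =
  ((g true true true + g true true false + g true false true + g true false false
   + g false true true + g false true false + g false false true + g false false false)
   / 8)%:E.
Proof.
move=> g0; pose G (z : T * T * T) := (g (lower z.1.1) (lower z.1.2) (lower z.2))%:E.
have mG : measurable_fun ((I `*` I) `*` I) G.
  apply: measurable_funTS; apply/measurable_EFinP.
  apply: (measurable_bool (b := fun z : T * T * T => lower z.1.1)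
    (F := fun b (z : T * T * T) => g b (lower z.1.2) (lower z.2))).
    apply: measurableT_comp => //.
    by apply: measurableT_comp; exact: measurable_fst.
  move=> b; apply: (measurable_bool (b := fun z : T * T * T => lower z.1.2)
    (F := fun c (z : T * T * T) => g b c (lower z.2))).
    apply: measurableT_comp => //.
    by apply: measurableT_comp; [exact: measurable_snd|exact: measurable_fst].
  move=> c; apply: (measurable_bool (b := fun z : T * T * T => lower z.2)
    (F := fun e (z : T * T * T) => g b c e)); last by move=> e; exact: measurable_cst.
  by apply: measurableT_comp => //; exact: measurable_snd.
have G0 z : ((I `*` I) `*` I) z -> (0 <= G z)%E by move=> _; rewrite lee_fin.
rewrite -/G.
transitivity (\int[@plane_measure R]_(s in I `*` I) (\int[mu]_(t in I) G (s, t)))%E.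
  exact: (fubini_tonelli_on (@plane_measure R) mu (@measurable_unitI2 R)
    (@measurable_unitI R) mG G0).
rewrite (eq_integral (fun s => ((g (lower s.1) (lower s.2) true
    + g (lower s.1) (lower s.2) false) / 2)%:E)).
  rewrite (integral_half2 (g := fun b c => (g b c true + g b c false) / 2)).
    by congr EFin; field.
  by move=> b c; rewrite divr_ge0 // addr_ge0.
by move=> s _; rewrite -integral_half.
Qed.

Lemma graphon_two_block (x y : R) : 0 <= x <= 1 -> 0 <= y <= 1 ->
  graphon (two_block x y).
Proof.
move=> x01 y01; split.
- apply: (@measurable_funTS _ _ (T * T)%type).
  apply: (measurable_bool (b := fun z : T * T => lower z.1)
    (F := fun b (z : T * T) => if b == lower z.2 then x else y)).
    by apply: measurableT_comp => //; exact: measurable_fst.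
  move=> b; apply: (measurable_bool (b := fun z : T * T => lower z.2)
    (F := fun c (z : T * T) => if b == c then x else y)).
    by apply: measurableT_comp => //; exact: measurable_snd.
  by move=> c; exact: measurable_cst.
- by move=> s t _ _; rewrite /two_block; case: ifP.
- by move=> s t _ _; rewrite /two_block eq_sym.
Qed.

Lemma graphon_expect_two_block (g : R -> R) (x y : R) : 0 <= g x -> 0 <= g y ->
  graphon_expect g (two_block x y) = ((g x + g y) / 2)%:E.
Proof.
move=> gx gy.
have := @integral_half2 (fun b c => g (if b == c then x else y)) _.
rewrite /= (_ : (g x + g y + g y + g x) / 4 = (g x + g y) / 2); last by field.
by apply => b c; case: ifP.
Qed.

Lemma triangle_density_two_block (x y : R) : 0 <= x -> 0 <= y ->
  triangle_density (two_block x y) = ((x ^+ 3 + 3 * x * y ^+ 2) / 4)%:E.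
Proof.
move=> x0 y0; pose w (b c : bool) := if b == c then x else y.
have := @integral_half3 (fun b c d => w b c * w b d * w c d) _.
rewrite /w /= => H.
rewrite (_ : _ / 4 = (x * x * x + x * y * y + y * x * y + y * y * x
  + y * y * x + y * x * y + x * y * y + x * x * x) / 8); last by field.
by apply: H => b c d; rewrite !mulr_ge0 //; case: ifP.
Qed.

End HalfIntegrals.

(** * The constant graphon is not optimal when [q / p] is small *)

Lemma rel_entropy_scaled (R : realType) (p s z : R) : 0 < p < 1 -> 0 < s ->
  0 < z -> s * p * z < 1 ->
  rel_entropy p (s * p * z) = s * p * z * (ln s + ln z)
    + (1 - s * p * z) * ln (1 - s * p * z) - (1 - s * p * z) * ln (1 - p).
Proof.
move=> /andP[p0 p1] s0 z0 z1.
rewrite /rel_entropy (_ : s * p * z / p = s * z); last by field; rewrite gt_eqF.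
rewrite lnM ?posrE // ln_div ?posrE ?subr_gt0 //; ring.
Qed.

Lemma xlnx_compl_bounds (R : realType) (z : R) : 0 <= z < 1 ->
  - z <= (1 - z) * ln (1 - z) <= - z + z ^+ 2.
Proof.
move=> /andP[z0 z1]; have z10 : 0 < 1 - z by lra.
have L : ln (1 - z) <= - z by apply: le_ln1Dx; lra.
apply/andP; split; last by have := ler_wpM2l (ltW z10) L; lra.
by have := h_ge0 (ltW z10); rewrite /h; lra.
Qed.

(** A zero of [f r] gives a two-block graphon with the same triangle density
    and, to first order in [p], the same entropy as the constant [p r].
    Shrinking both by [s < 1] changes the difference of the entropies by
    [s p ln s] times the excess [e] of the mean of the two-block graphon, which is
    negative and dominates the error of second order in [p] once
    [ln s < - p / e]. *)
Lemma two_block_gain (R : realType) (r : R) : f_has_zero r ->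
  exists x y e : R, [/\ 0 < x <= 1, 0 < y <= 1, x ^+ 3 + 3 * x * y ^+ 2 = 4 * r ^+ 3,
    0 < e & forall p s : R, 0 < p < 1 -> 0 < s < expR (- p / e) ->
    (rel_entropy p (s * p * x) + rel_entropy p (s * p * y)) / 2 <
      rel_entropy p (s * p * r)].
Proof.
move=> /[dup] -[r01 _] /(f_has_zeroE r01)[u u01 [rE ry]].
have /andP[r0 r1] := r01; have /andP[u0 u1] := u01.
have v1 := f_other1_gt1 u01; have uv := f_other1_eq u01.
have m1 := curve_mean_gt1 u01.
have /f_eq0E := rE; move=> /(_ r0 u01); rewrite /f f_otherM //.
move: m1; rewrite /curve_mean; move: (f_other 1 u) v1 uv ry => v v1 uv ry m1 fE.
pose x := r * u; pose y := r * v; pose e := (x + y) / 2 - r.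
have x0 : 0 < x by rewrite mulr_gt0.
have y0 : 0 < y by rewrite mulr_gt0 // (lt_trans ltr01).
have x1 : x <= 1 by rewrite mulr_ile1 // ltW.
have e0 : 0 < e.
  rewrite (_ : e = r * ((u + v) / 2 - 1)); last by rewrite /e /x /y; field.
  by rewrite mulr_gt0 // subr_gt0.
exists x, y, e; split => //; rewrite ?x0 ?y0 //.
  by rewrite -uv /x /y; ring.
move=> p s p01 /andP[s0 se]; have /andP[p0 p1] := p01.
have Ls : ln s * e < - p.
  by rewrite -ltr_pdivlMr // -ltr_expR (lnK s0).
have s1 : s < 1.
  by apply: (lt_trans se); rewrite expR_lt1 mulNr oppr_lt0 divr_gt0.
have sp0 : 0 < s * p by rewrite mulr_gt0.
have sp1 : s * p < 1 by rewrite mulr_ilt1 // ltW.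
have sp z : 0 < z -> z <= 1 -> 0 <= s * p * z < 1.
  move=> z0 z1; rewrite mulr_ge0 ?(ltW sp0) ?(ltW z0) //=.
  by rewrite (le_lt_trans _ sp1) // ler_piMr // ltW.
have spx := sp _ x0 x1; have spy := sp _ y0 ry; have spr := sp _ r0 (ltW r1).
rewrite !rel_entropy_scaled //; try by case/andP: spx; try by case/andP: spy; try by case/andP: spr.
all: try by case/andP: spy.
all: try by case/andP: spr.
have /andP[_ bx] := xlnx_compl_bounds spx.
have /andP[_ hy] := xlnx_compl_bounds spy.
have /andP[br _] := xlnx_compl_bounds spr.
have Lp : ln (1 - p) <= 0 by rewrite ln_le0 //; lra.
have Lpe : ln (1 - p) * e <= 0 by rewrite mulr_le0_ge0 // ltW.
have sq : s * p * ((x ^+ 2 + y ^+ 2) / 2) <= p.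
  have xx : x ^+ 2 <= 1 by rewrite exprn_ile1 // ltW.
  have yy : y ^+ 2 <= 1 by rewrite exprn_ile1 // ltW.
  apply: (@le_trans _ _ (s * p)); first by rewrite ler_piMr ?(ltW sp0) //; lra.
  by rewrite ler_piMl // ltW.
have key : s * p * (ln s * e + s * p * ((x ^+ 2 + y ^+ 2) / 2) + ln (1 - p) * e) < 0.
  by rewrite pmulr_rlt0 //; lra.
have fE' : s * p * (x * ln x + y * ln y) = s * p * (2 * (r * ln r) + 2 * e).
  by congr (_ * _); move: fE; rewrite -/x -/y /h /e; lra.
move: key; rewrite {1 2}/e => key.
move: fE' bx hy br; rewrite /e; lra.
Qed.

Lemma const_not_minimizer (R : realType) (r x y p q : R) : 0 < r ->
  0 < x <= 1 -> 0 < y <= 1 -> x ^+ 3 + 3 * x * y ^+ 2 = 4 * r ^+ 3 ->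
  0 < p < 1 -> 0 < q -> q / (r * p) <= 1 ->
  (rel_entropy p (q / (r * p) * p * x) + rel_entropy p (q / (r * p) * p * y)) / 2 <
    rel_entropy p q ->
  ~ LT_minimizer p q (const_graphon q).
Proof.
move=> r0 /andP[x0 x1] /andP[y0 y1] xyr p01 q0; have /andP[p0 p1] := p01.
set s := q / (r * p) => s1 H [_ minq].
have s0 : 0 < s by rewrite divr_gt0 // mulr_gt0.
have sp z : 0 < z -> z <= 1 -> 0 <= s * p * z <= 1.
  move=> z0 z1; have sp0 : 0 <= s * p by rewrite mulr_ge0 // ltW.
  have sp1 : s * p <= 1 by rewrite mulr_ile1 // ltW.
  by rewrite mulr_ge0 ?(ltW z0) //= mulr_ile1 ?(ltW z0).
have spx := sp _ x0 x1; have spy := sp _ y0 y1.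
have /andP[spx0 _] := spx; have /andP[spy0 _] := spy.
have qE : s * p * r = q by rewrite /s; field; rewrite !gt_eqF.
have fW : LT_feasible q (two_block (s * p * x) (s * p * y)).
  split; first exact: graphon_two_block.
  rewrite triangle_density_two_block // lee_fin.
  rewrite (_ : _ / 4 = (s * p) ^+ 3 * ((x ^+ 3 + 3 * x * y ^+ 2) / 4)); last by field.
  by rewrite xyr -qE [4 * _]mulrC mulfK ?pnatr_eq0 // [(s * p * r) ^+ 3]exprMn.
have := minq _ fW; rewrite graphon_expect_const graphon_expect_two_block ?rel_entropy_ge0 //.
by rewrite lee_fin leNgt H.
Qed.

(** * Thresholds for the constant graphon *)

Theorem theorem2p1 (R : realType) :
  exists rbar rlow : R,
    [/\ unique (fun r : R => 0 < r < 1 /\ 3 / 2 * r * ln r - r + 1 = 0) rbar,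
        466 / 1000 <= rbar < 467 / 1000,
        f_has_zero rlow /\ (forall r : R, f_has_zero r -> r <= rlow),
        209 / 1000 <= rlow < 210 / 1000 &
        exists qlow qbar : R -> R,
          [/\ (forall p : R, 0 < p < 1 ->
                 [/\ 0 < qlow p, qlow p <= qbar p & qbar p <= p]),
              (forall p q : R, 0 < p < 1 -> qbar p < q < p ->
                 LT_unique_minimizer p q (const_graphon q)),
              (forall p q : R, 0 < p < 1 -> 0 < q < qlow p ->
                 ~ LT_minimizer p q (const_graphon q)),
              qlow p / p @[p --> 0^'+] --> rlow &
              qbar p / p @[p --> 0^'+] --> rbar]].
Proof.
have [rbar rb rbE] := rbar_exists R.
have [rlow [zr zmax rl]] := rlow_exists R.
have [/andP[b1 b2] /andP[l1 l2]] := (rb, rl).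
have [x [y [e [x01 y01 xyr e0 gain]]]] := two_block_gain zr.
have l0 : 0 < rlow by clear -l1; lra.
have rb01 : 0 < rbar < 1 by clear -b1 b2; lra.
have rlow_rbar : rlow <= rbar by clear -b1 l2; lra.
have rbar1 : rbar <= 1 by clear -b2; lra.
exists rbar, rlow; split; [|exact: rb|by split|exact: rl|].
  by split => // s [s01 sE]; exact: (rbar_unique rb01 rbE s01 sE).
have [p0 p0E] : exists p0 : R, p0 = 1 / 250 by exists (1 / 250).
have p00 : 0 < p0 by clear -p0E; lra.
(* Beyond [p0] the interval between [qbar p] and [p] is empty. *)
exists (fun p => rlow * p * expR (- p / e)), (fun p => if p <= p0 then rbar * p else p).
split.
- move=> p /andP[pp0 p1].
  have E1 : expR (- p / e) <= 1 by rewrite expR_le1 mulNr oppr_le0 divr_ge0 // ltW.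
  have lp : rlow * p * expR (- p / e) <= rlow * p.
    by rewrite ler_piMr // mulr_ge0 // ltW.
  split; first by rewrite !mulr_gt0 ?expR_gt0.
    apply: (le_trans lp); case: ifP => _; last by rewrite ler_piMl ?(ltW pp0) ?(le_trans rlow_rbar).
    by rewrite ler_pM2r.
  by case: ifP => _ //; rewrite ler_piMl ?(ltW pp0).
- move=> p q /andP[pp0 p1]; case: ifP => [pp|_] /andP[q1 q2]; last first.
    by have := lt_trans q1 q2; rewrite ltxx.
  apply: const_unique_minimizer; [by rewrite pp0 -p0E|exact: q2|].
  by apply: le_lt_trans q1; rewrite ler_pM2r.
- move=> p q p01 /andP[q0 ql]; have /andP[pp0 p1] := p01.
  have rp0 : 0 < rlow * p by rewrite mulr_gt0.
  have s0 : 0 < q / (rlow * p) by rewrite divr_gt0.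
  have s1 : q / (rlow * p) < expR (- p / e) by rewrite ltr_pdivrMr // mulrC.
  have s1' : q / (rlow * p) <= 1.
    by apply: (le_trans (ltW s1)); rewrite expR_le1 mulNr oppr_le0 divr_ge0 // ltW.
  apply: (const_not_minimizer l0 x01 y01 xyr p01 q0 s1').
  have := gain p (q / (rlow * p)) p01; rewrite s0 s1 => /(_ isT).
  rewrite (_ : q / (rlow * p) * p * rlow = q) //.
  by field; rewrite !gt_eqF.
- have cg : {for (0 : R), continuous (fun p : R => rlow * expR (- p / e))}.
    apply: cvgM; first exact: cvg_cst.
    apply: (@continuous_comp _ _ _ (fun p : R => - p / e) expR); last exact: continuous_expR.
    by apply: cvgM; [apply: cvgN; exact: cvg_id|exact: cvg_cst].
  have : rlow * expR (- p / e) @[p --> 0^'+] --> rlow * expR (- 0 / e).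
    by apply: cvg_at_right_filter; exact: cg.
  rewrite oppr0 mul0r expR0 mulr1 => lim; apply: cvg_trans lim.
  apply: near_eq_cvg; near=> p; have pp0 : 0 < p by near: p; exact: nbhs_right_gt.
  by rewrite [RHS]mulrAC mulfK // gt_eqF.
- have lim : (fun=> rbar) p @[p --> (0 : R)^'+] --> rbar by exact: cvg_cst.
  apply: cvg_trans lim; apply: near_eq_cvg; near=> p; have pp0 : 0 < p by near: p; exact: nbhs_right_gt.
  have -> : p <= p0 by near: p; exact: nbhs_right_le.
  by rewrite mulfK // gt_eqF.
Unshelve. all: by end_near.
Qed.
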